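(* Let $G,H$ be Polish groups, let $X$ be a Polish $G$-space, let $Y$ be a Polish $H$-space, and let $f\colon X\to Y$ be a $*$-reduction from $E^G_X$ to $E^H_Y$. Then there is a $G$-invariant dense $G_\delta$ subset $X_0$ of $X$ and an $H$-invariant non-meager Baire measurable subset $Y_0$ of $Y$ such that the induced map $[f]\colon [x]\mapsto [f(x)]$, restricted to $X_0/G$, is an isomorphism from the digraph $\mathcal{B}(X_0/G)$ to the digraph $\mathcal{B}(Y_0/H)$.
   Context: A Polish $G$-space is a Polish space $X$ with a continuous action $G\times X\to X$ of the Polish group $G$; $E^G_X$ is its orbit equivalence relation on $X$ and $[x]$ denotes the orbit of $x$. A set is Baire measurable if it has the Baire property; a map is Baire measurable if preimages of open sets have the Baire property. A map $f\colon X\to Y$ between Polish spaces is category preserving if $f^{-1}(M)$ is meager in $X$ for every meager $M\subseteq Y$. A $*$-reduction from an equivalence relation $E$ on $X$ to an equivalence relation $F$ on $Y$ is a Baire measurable category preserving map $f\colon X\to Y$ such that $x\,E\,x'\iff f(x)\,F\,f(x')$ for all $x,x'\in X$. A sequence $(g_n)$ in a Polish group is right-Cauchy if it is Cauchy with respect to some (equivalently, any) compatible right-invariant metric. For points $x,x'$ of a Polish $G$-space $X$, $x$ right-embeds in $x'$ if there is a right-Cauchy sequence $(g_n)$ in $G$ such that $g_n x'$ converges to $x$; this depends only on the orbits of $x$ and $x'$. For a $G$-invariant $C\subseteq X$, the (right) Becker digraph $\mathcal{B}(C/G)$ has vertex set $C/G=\{[x]\mid x\in C\}$ and an arrow from $[x]$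 to $[x']$ exactly when $x$ right-embeds in $x'$. *)

(* Defs.v *)
From HB Require Import structures.
From mathcomp Require Import all_boot all_order all_algebra.
From mathcomp Require Import all_classical all_reals all_analysis borel_hierarchy.

Set Implicit Arguments.
Unset Strict Implicit.
Unset Printing Implicit Defensive.

Import Order.TTheory GRing.Theory Num.Theory.
Import numFieldNormedType.Exports.

Local Open Scope classical_set_scope.
Local Open Scope ring_scope.

HB.structure Definition PreTopologicalGroup := {G of Topological G & Group G}.

HB.mixin Record PreTopologicalGroup_isTopologicalGroup G
    & PreTopologicalGroup G := {
  mulg_continuous : continuous (fun x : G * G => (x.1 * x.2)%g) ;
  invg_continuous : continuous (fun x : G => (x^-1)%g) ;
}.

#[short(type="topologicalGroupType")]
HB.structure Definition TopologicalGroup :=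
  {G of PreTopologicalGroup G & PreTopologicalGroup_isTopologicalGroup G}.

(* Metrics are bare functions, since right-Cauchyness quantifies over metrics
   on a fixed topological group. *)
Section metrics.
Context {R : realType} {T : topologicalType}.
Implicit Types (d : T -> T -> R) (u : nat -> T).

Definition is_metric d :=
  [/\ forall x y, 0 <= d x y,
      forall x y, d x y = 0 <-> x = y,
      forall x y, d x y = d y x &
      forall x y z, d x z <= d x y + d y z].

Definition compatible_metric d :=
  is_metric d /\
  forall (x : T) (A : set T),
    nbhs x A <-> exists2 e : R, 0 < e & [set y | d x y < e] `<=` A.

Definition cauchy_for d u :=
  forall e : R, 0 < e ->
    exists N : nat, forall m n : nat, (N <= m)%N -> (N <= n)%N -> d (u m) (u n) < e.

Definition complete_metric d :=
  forall u, cauchy_for d u -> exists l : T, u @ \oo --> l.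

End metrics.

Definition separable (T : topologicalType) :=
  exists2 D : set T, countable D & dense D.

Definition polish (R : realType) (T : topologicalType) :=
  separable T /\ exists2 d : T -> T -> R, compatible_metric d & complete_metric d.

Section category.
Context {T : topologicalType}.
Implicit Types A : set T.

Definition nowhere_dense A := (closure A)° = set0.

Definition meager A :=
  exists2 F : nat -> set T, (forall n, nowhere_dense (F n)) & A = \bigcup_n F n.

Definition baire_measurable A :=
  exists2 U : set T, open U & meager (A `+` U).

End category.

Definition baire_measurable_map (X Y : topologicalType) (f : X -> Y) :=
  forall U : set Y, open U -> baire_measurable (f @^-1` U).

Definition category_preserving (X Y : topologicalType) (f : X -> Y) :=
  forall M : set Y, meager M -> meager (f @^-1` M).

Definition star_reduction (X Y : topologicalType)
    (E : X -> X -> Prop) (F : Y -> Y -> Prop) (f : X -> Y) :=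
  [/\ baire_measurable_map f, category_preserving f &
      forall x x', E x x' <-> F (f x) (f x')].

Definition continuous_action (G : topologicalGroupType) (X : topologicalType)
    (act : G -> X -> X) :=
  [/\ forall x, act 1%g x = x,
      forall g h x, act (g * h)%g x = act g (act h x) &
      continuous (fun p : G * X => act p.1 p.2)].

Definition polish_group (R : realType) (G : topologicalGroupType) := polish R G.

Definition polish_Gspace (R : realType) (G : topologicalGroupType)
    (X : topologicalType) (act : G -> X -> X) :=
  polish R X /\ continuous_action act.

Definition right_invariant (R : realType) (G : topologicalGroupType)
    (d : G -> G -> R) :=
  forall g h k : G, d (g * k)%g (h * k)%g = d g h.

Definition right_cauchy (R : realType) (G : topologicalGroupType) (g : nat -> G) :=
  exists d : G -> G -> R,
    [/\ compatible_metric d, right_invariant d & cauchy_for d g].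

Record digraph (T : Type) := Digraph {
  vertex : set T ;
  arrow : T -> T -> Prop
}.

Definition digraph_iso (S T : Type) (D : digraph S) (D' : digraph T)
    (phi : S -> T) :=
  set_bij (vertex D) (vertex D') phi /\
  forall u v, vertex D u -> vertex D v ->
    (arrow D u v <-> arrow D' (phi u) (phi v)).

Section Gspace.
Context {G : topologicalGroupType} {X : topologicalType} (act : G -> X -> X).
Implicit Types (x : X) (C : set X).

Definition orbit_of x : set X := [set act g x | g in [set: G]].

Definition orbit_eq x x' := exists g : G, act g x = x'.

Definition invariant_set C := forall (g : G) x, C x -> C (act g x).

Definition orbit_space C : set (set X) := [set orbit_of x | x in C].

Definition right_embeds (R : realType) x x' :=
  exists g : nat -> G, right_cauchy R g /\ act (g n) x' @[n --> \oo] --> x.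

Definition becker_digraph (R : realType) C : digraph (set X) := {|
  vertex := orbit_space C ;
  arrow := fun O O' => exists x x',
    [/\ C x, C x', O = orbit_of x, O' = orbit_of x' & right_embeds R x x']
|}.

End Gspace.

(* The map [x] |-> [f x] between orbit sets; see orbit_mapE. *)
Definition orbit_map (H : topologicalGroupType) (X Y : topologicalType)
    (actY : H -> Y -> Y) (f : X -> Y) (O : set X) : set Y :=
  \bigcup_(x in O) orbit_of actY (f x).

Lemma orbit_of_eq (G : topologicalGroupType) (X : topologicalType)
    (act : G -> X -> X) (x x' : X) :
  continuous_action act -> orbit_eq act x x' ->
  orbit_of act x = orbit_of act x'.
Proof.
move=> [a1 aM _] [k <-]; apply/seteqP; split => [_ [g _ <-]|_ [g _ <-]].
  by exists (g * k^-1)%g => //; rewrite -aM -mulgA mulVg mulg1.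
by exists (g * k)%g => //; rewrite aM.
Qed.

Lemma orbit_mapE (G H : topologicalGroupType) (X Y : topologicalType)
    (actX : G -> X -> X) (actY : H -> Y -> Y) (f : X -> Y) (x : X) :
  continuous_action actX -> continuous_action actY ->
  (forall x x', orbit_eq actX x x' -> orbit_eq actY (f x) (f x')) ->
  orbit_map actY f (orbit_of actX x) = orbit_of actY (f x).
Proof.
move=> cX cY fE; apply/seteqP; split => [y [x' [g _ gx] fx'y]|y fxy].
  by rewrite (orbit_of_eq (x' := f x') cY)//; apply: fE; exists g.
by exists x => //; exists 1%g => //; case: cX.
Qed.

(* Hence arrows of the Becker digraph do not depend on representatives. *)
Lemma right_embeds_orbit (R : realType) (G : topologicalGroupType)
    (X : topologicalType) (act : G -> X -> X) (h k : G) (x x' : X) :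
  continuous_action act -> right_embeds act R x x' ->
  right_embeds act R (act h x) (act k x').
Proof.
move=> [a1 aM ac] [g [[d [dT dr dC]] gx]].
exists (fun n => h * g n * k^-1)%g; split; last first.
  have -> : (fun n => act (h * g n * k^-1)%g (act k x')) =
            act h \o (fun n => act (g n) x').
    by apply/funext => n; rewrite -aM -mulgA mulVg mulg1 aM.
  apply: (@cvg_comp _ _ _ (fun n => (h, act (g n) x')) (fun p => act p.1 p.2)
    _ (nbhs (h, x))); last exact: (ac (h, x)).
  by apply: cvg_pair => //=; exact: cvg_cst.
exists d; split => // e e0.
have [[d0 dI ds dt] dn] := dT.
have conj_cvg : (h * z * h^-1)%g @[z --> (1%g : G)] --> (1%g : G).
  have mc (F : set_system G) (FF : Filter F) (a b : G -> G) (p q : G) :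
      a @ F --> p -> b @ F --> q -> (a z * b z)%g @[z --> F] --> (p * q)%g.
    move=> ap bq; apply: (@cvg_comp _ _ _ (fun z => (a z, b z))
      (fun p => p.1 * p.2)%g _ (nbhs (p, q))); first exact: cvg_pair.
    exact: (@mulg_continuous G (p, q)).
  have cst (k' : G) : (fun=> k') @ nbhs (1%g : G) --> k' by exact: cvg_cst.
  have := mc _ (nbhs_filter _) _ _ _ _ (mc _ (nbhs_filter _) _ id _ _ (cst h)
    (@cvg_id _ _)) (cst h^-1%g).
  by rewrite mulg1 mulgV.
have /conj_cvg/dn[r r0 rP] : nbhs (1%g : G) [set y | d 1%g y < e].
  by apply/dn; exists e.
have [N NP] := dC r r0; exists N => m n Nm Nn.
rewrite dr -(dr _ _ ((h * g m)^-1)%g) mulgV.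
have := rP (g n * (g m)^-1)%g; rewrite /= invgM !mulgA; apply.
by rewrite -(mulgV (g m)) dr NP.
Qed.

Lemma becker_arrowE (R : realType) (G : topologicalGroupType)
    (X : topologicalType) (act : G -> X -> X) (C : set X) (x x' : X) :
  continuous_action act -> C x -> C x' ->
  arrow (becker_digraph act R C) (orbit_of act x) (orbit_of act x') <->
  right_embeds act R x x'.
Proof.
move=> cA Cx Cx'; split => [[y [y' [_ _ xy x'y' yy']]]|xx']; last first.
  by exists x, x'.
have [a1 _ _] := cA.
have [h _ <-] : orbit_of act y x by rewrite -xy; exists 1%g.
have [k _ <-] : orbit_of act y' x' by rewrite -x'y'; exists 1%g.
exact: right_embeds_orbit.
Qed.

(* Main.v *)
Require Import Defs.
From HB Require Import structures.
From mathcomp Require Import all_boot all_order all_algebra lra.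
From mathcomp Require Import all_classical all_reals all_analysis borel_hierarchy.

Set Implicit Arguments.
Unset Strict Implicit.
Unset Printing Implicit Defensive.

Import Order.TTheory GRing.Theory Num.Theory.

Local Open Scope classical_set_scope.
Local Open Scope ring_scope.

(* Orbit continuity: off a meager set, g near 1 moves f x to f (g x) by an
   element of H near 1, locally uniformly in x. Hence, on an invariant comeager
   set, a Baire measurable homomorphism of orbit equivalence relations maps
   right-Cauchy witnesses of right-embeddings to such witnesses. A
   *-reduction f is such a homomorphism; uniformizing the analytic set
   {(y, x) | f x E y} gives a second one, h, from the saturation of f(X) back to
   X, with h (f x) in the orbit of x, and category preservation makes the
   comeager set belonging to h pull back to a comeager subset of X. *)

(** * The comeager filter *)

(** The obstacle is that a homomorphism only provides, for each pair [x], [g x], some element of [H]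
    moving [f x] to [f (g x)], with no bound on its size; a right-Cauchy sequence in [G] then says
    nothing about [H]. Right invariance makes a bound usable: the distance from [g] to [k] is the
    size of [g * k^-1], which leads from [k x] to [g x]. Right-Cauchy thus means that late points of
    the sequence in the orbit are joined by small group elements. The two homomorphisms are not
    symmetric: [h] respects orbits only on the saturation and is not known to be category
    preserving. This is why orbit continuity is proved for a map with an invariant domain [D] that
    has the Baire property. The descriptive set theory is confined to continuous images of sets that
    are closed in a G-delta set. One category argument gives both their Baire property and their
    sections. *)

Definition comeager (T : topologicalType) : set_system T :=
  [set A | meager (~` A)].

Notation "'\forall*' x , P" := (comeager [set x | P])
  (at level 200, x name, P at level 200).

Section comeager_filter.
Context {T : topologicalType}.
Implicit Types A O N : set T.

Lemma nowhere_dense_setC A : nowhere_dense A <-> dense (~` closure A).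
Proof.
split=> [A0 O [x Ox] oO|dA].
  apply: contrapT => O0; suff : (closure A)° x by rewrite A0.
  rewrite /interior nbhsE; exists O => // y Oy; apply: contrapT => ny.
  by apply: O0; exists y.
apply/seteqP; split=> // x; rewrite /interior nbhsE => -[ O [oO Ox] OA].
have [|y [Oy]] := dA O _ oO; first by exists x.
by case; exact: OA.
Qed.

Lemma comeagerP A : comeager A <->
  exists O : nat -> set T,
    [/\ forall n, open (O n), forall n, dense (O n) & \bigcap_n O n `<=` A].
Proof.
split=> [[F F0 AF]|[ O [oO dO OA]]].
  exists (fun n => ~` closure (F n)); split=> [n|n|x Fx].
  - exact/closed_openC/closed_closure.
  - exact/nowhere_dense_setC.
  - apply: contrapT => Ax.
    have [n _ Fnx] : (\bigcup_n F n) x by rewrite -AF.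
    by apply: (Fx n) => //; exact: subset_closure.
(* [meager] asks for equality with a union of nowhere dense sets, not for inclusion in one; so each
   complement of [O n] is cut down to the complement of [A]. *)
exists (fun n => ~` A `&` ~` O n) => [n|].
  apply/nowhere_dense_setC => N N0 oN.
  have [x [Nx Ox]] := dO n N N0 oN; exists x; split => // clx.
  have [y [[_ +] Oy]] := clx _ (open_nbhs_nbhs (conj (oO n) Ox)).
  by apply.
apply/seteqP; split=> [x Ax|x [n _ []]//].
apply: contrapT => nx; apply: (Ax); apply: OA => n _.
by apply: contrapT => nOx; apply: nx; exists n.
Qed.

Lemma comeager_open_dense A : open A -> dense A -> comeager A.
Proof. by move=> oA dA; apply/comeagerP; exists (fun=> A); split=> // x /(_ 0%N I). Qed.

Lemma comeager_bigcap (A : nat -> set T) :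
  (forall n, comeager (A n)) -> comeager (\bigcap_n A n).
Proof.
move=> cA; have /choice[ O OP] := fun n => (comeagerP (A n)).1 (cA n).
apply/comeagerP; exists (fun n => if unpickle n is Some (i, j) then O i j else setT).
split=> [n|n|x Ox i _].
- by case: unpickle => [[i j]|]; [have [] := OP i | exact: openT].
- by case: unpickle => [[i j]|]; [have [] := OP i | move=> N [x Nx]; exists x].
- have [_ _] := OP i; apply => j _.
  by have := Ox (pickle (i, j)) I; rewrite pickleK.
Qed.

Lemma comeager_forall (I : countType) (A : I -> set T) :
  (forall i, comeager (A i)) -> \forall* x, forall i, A i x.
Proof.
move=> cA.
have /comeager_bigcap : forall n,
    comeager (if unpickle n is Some i then A i else setT).
  move=> n; case: unpickle => [i//|].
  by apply: comeager_open_dense; [exact: openT|move=> N [x Nx]; exists x].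
case/comeagerP=> O [oO dO OA]; apply/comeagerP; exists O; split=> // x Ox i.
by have := OA x Ox (pickle i) Logic.I; rewrite pickleK.
Qed.

Global Instance comeager_filter : Filter (@comeager T).
Proof.
have S A O : A `<=` O -> comeager A -> comeager O.
  move=> AO /comeagerP[U [oU dU UA]]; apply/comeagerP; exists U.
  by split=> //; exact: subset_trans AO.
split=> //.
- by apply: comeager_open_dense; [exact: openT|move=> N [x Nx]; exists x].
- move=> A O cA cO.
  have /comeager_forall : forall b : bool, comeager (if b then A else O) by case.
  by apply: S => x Ax; split; [exact: (Ax true)|exact: (Ax false)].
Qed.

Lemma comeager_open_in O N : open O -> open N ->
  (forall N', open N' -> N' !=set0 -> N' `<=` N -> N' `&` O !=set0) ->
  \forall* x, N x -> O x.
Proof.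
move=> oO oN dO; apply: (@filterS _ _ _ (O `|` ~` closure N)).
  by move=> x [? _ //|nN /= /subset_closure /nN].
apply: comeager_open_dense; first exact/openU/closed_openC/closed_closure.
move=> N' N'0 oN'; have [NN'|NN'] := pselect (N' `&` N !=set0).
  have [|x [[N'x _] Ox]] := dO (N' `&` N) (openI oN' oN) NN'; first by move=> ? [].
  by exists x; split; [|left].
case: N'0 => x N'x; exists x; split=> //; right=> clx.
have [y [Ny N'y]] := clx _ (open_nbhs_nbhs (conj oN' N'x)).
by apply: NN'; exists y.
Qed.

(** The boundary of a closed set is nowhere dense. *)
Lemma comeager_interior A : closed A -> \forall* x, A x -> A° x.
Proof.
move=> cA; apply: (@filterS _ _ _ (A° `|` ~` A)); first by move=> x [? _|nA /= /nA].
apply: comeager_open_dense.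
  by apply: openU; [exact: open_interior|exact: closed_openC].
move=> N N0 oN; have [NA|/existsNP[x /not_implyP[Nx Ax]]] := pselect (N `<=` A).
  case: N0 => x Nx; exists x; split=> //; left.
  by rewrite /interior nbhsE; exists N.
by exists x; split => //; right.
Qed.

Lemma comeager_closure A : open A -> \forall* x, closure A x -> A x.
Proof.
move=> oA; have := comeager_interior (open_closedC oA).
apply: filterS => x /= Ai clA; apply: contrapT => /Ai xi.
by have [y [Ay /interior_subset]] := clA _ (open_nbhs_nbhs (conj (open_interior _) xi)).
Qed.

End comeager_filter.

Lemma comeager_preimage (S T : topologicalType) (f : S -> T) (A : set T) :
  continuous f -> (forall O, open O -> open (f @` O)) ->
  comeager A -> comeager (f @^-1` A).
Proof.
move=> cf fo /comeagerP[ O [oO dO OA]]; apply/comeagerP.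
exists (fun n => f @^-1` O n); split=> [n|n N [x Nx] oN|x Ox].
- by apply: open_comp => // ? _; exact: cf.
- have [||_ [[y Ny <-] Oy]] := dO n (f @` N); [by exists (f x); exists x|exact: fo|].
  by exists y.
- by apply: OA => n _; exact: Ox.
Qed.

(** * Metrics and Polish spaces *)

Definition open_base (T : topologicalType) (B : nat -> set T) :=
  (forall n, open (B n)) /\
  forall x A, nbhs x A -> exists n, B n x /\ B n `<=` A.

Section metric.
Context {R : realType} {T : topologicalType} (d : T -> T -> R).
Hypothesis dT : compatible_metric d.

Lemma cmetric_ge0 x y : 0 <= d x y. Proof. by case: dT => -[]. Qed.

Lemma cmetric_sym x y : d x y = d y x. Proof. by case: dT => -[]. Qed.

Lemma cmetric_triangle x y z : d x z <= d x y + d y z.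
Proof. by case: dT => -[]. Qed.

Lemma cmetric_refl x : d x x = 0. Proof. by case: dT => -[_ /(_ x x)[_ ->]]. Qed.

Lemma cmetric_eq0 x y : d x y = 0 -> x = y.
Proof. by case: dT => -[_ /(_ x y)[]]. Qed.

Lemma cmetric_nbhsP x A :
  nbhs x A <-> exists2 e : R, 0 < e & [set y | d x y < e] `<=` A.
Proof. by case: dT. Qed.

Lemma mball_open x e : open [set y | d x y < e].
Proof.
rewrite openE => y /= xy; apply/cmetric_nbhsP; exists (e - d x y).
  by rewrite subr_gt0.
by move=> z /=; rewrite ltrBrDl; exact/le_lt_trans/cmetric_triangle.
Qed.

Lemma mball_nbhs x e : 0 < e -> nbhs x [set y | d x y < e].
Proof. by move=> e0; apply/cmetric_nbhsP; exists e. Qed.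

Lemma cmetric_cvgP (u : nat -> T) x : u @ \oo --> x <->
  forall e : R, 0 < e -> \forall n \near \oo, d x (u n) < e.
Proof.
split=> [ux e e0|H A /cmetric_nbhsP[e e0 eA]]; first exact: ux (mball_nbhs x e0).
by apply: filterS (H e e0) => n; exact: eA.
Qed.

Lemma cmetric_hausdorff : hausdorff_space T.
Proof.
move=> x y cxy; apply: cmetric_eq0; apply: contrapT => /eqP xy.
have r0 : 0 < d x y / 2 by rewrite divr_gt0// lt_neqAle eq_sym xy cmetric_ge0.
have [z [/= xz yz]] := cxy _ _ (mball_nbhs x r0) (mball_nbhs y r0).
by have := cmetric_triangle x z y; rewrite (cmetric_sym z); lra.
Qed.

Lemma mball_shrink x O (e : R) : open O -> O x -> 0 < e ->
  exists U, [/\ open U, U x, closure U `<=` O &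
    forall y z, U y -> U z -> d y z < e].
Proof.
move=> oO Ox e0; have /cmetric_nbhsP[s s0 sO] := open_nbhs_nbhs (conj oO Ox).
pose r := Num.min e s / 2.
have r0 : 0 < r by rewrite divr_gt0// lt_min e0.
have re : r + r <= e by rewrite -splitr ge_min lexx.
have rs : r + r <= s by rewrite -splitr ge_min lexx orbT.
exists [set y | d x y < r]; split.
- exact: mball_open.
- by rewrite /= cmetric_refl.
- move=> y /(_ _ (mball_nbhs y r0))[z [/= xz yz]]; apply: sO => /=.
  by have := cmetric_triangle x z y; rewrite (cmetric_sym z); lra.
- move=> y z /= xy xz.
  by have := cmetric_triangle y x z; rewrite (cmetric_sym y x); lra.
Qed.

(** Cantor's intersection theorem. The diameter bound begins with [U 1], so that [U 0] may be any
    set, in particular the whole space. *)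
Lemma nested_limit (U : nat -> set T) (p : nat -> T) :
  complete_metric d -> (forall n, U n (p n)) ->
  (forall n, closure (U n.+1) `<=` U n) ->
  (forall n y z, U n.+1 y -> U n.+1 z -> d y z < n.+1%:R^-1) ->
  exists l, (forall n, U n l) /\ p @ \oo --> l.
Proof.
move=> dC Up clU diamU.
have UU m n : (m <= n)%N -> U n `<=` U m.
  move=> /subnK <-; elim: (n - m)%N => // k IH; apply: subset_trans IH.
  by rewrite addSn; apply: subset_trans (clU _); exact: subset_closure.
have [e e0|l pl] := dC p.
  have [N _ /(_ _ (leqnn _)) Ne] := near_infty_natSinv_lt (PosNum e0).
  exists N.+1 => m n Nm Nn; apply: lt_trans Ne.
  by apply: diamU; [exact: UU (Up m)|exact: UU (Up n)].
exists l; split => // n; apply: clU => A /pl[N _ NA].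
exists (p (maxn N n.+1)); split; last exact/NA/leq_maxl.
exact/UU/Up/leq_maxr.
Qed.

Lemma geometric_cauchy (u : nat -> T) :
  (forall n, d (u n.+1) (u n) < 2^-1 ^+ n) -> cauchy_for d u.
Proof.
move=> du e e0.
have dk n k : d (u (n + k)%N) (u n) <= 2^-1 ^+ n * (2 - 2 * 2^-1 ^+ k).
  elim: k => [|k IH]; first by rewrite addn0 cmetric_refl expr0 mulr1 subrr mulr0.
  rewrite addnS; apply: le_trans (cmetric_triangle _ (u (n + k)%N) _) _.
  have := du (n + k)%N; rewrite exprD exprS.
  by move: IH; set a := 2^-1 ^+ n; set b := 2^-1 ^+ k => ? ?; lra.
have dN N n : (N <= n)%N -> d (u n) (u N) <= 2 * 2^-1 ^+ N.
  move=> /subnKC <-; apply: le_trans (dk _ _) _.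
  rewrite mulrC ler_wpM2r ?exprn_ge0// gerBl mulr_ge0 ?exprn_ge0//.
have e4 : 0 < e / 4 by rewrite divr_gt0.
have [N _ /(_ _ (leqnn _)) Ne] := near_infty_natSinv_expn_lt (PosNum e4).
exists N => m n Nm Nn; apply: le_lt_trans (cmetric_triangle _ (u N) _) _.
have := dN _ _ Nm; have := dN _ _ Nn; rewrite (cmetric_sym _ (u n)).
move: Ne; rewrite /= div1r -exprVn; lra.
Qed.

Lemma cmetric_base : separable T -> exists B : nat -> set T, open_base B.
Proof.
case=> D /countable_injP[k kD] dD.
pose B i m := [set y : T | exists2 p, D p /\ k p = i & d p y < m.+1%:R^-1].
exists (fun n => if unpickle n is Some (i, m) then B i m else set0); split.
  move=> n; case: unpickle => [[i m]|]; last exact: open0.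
  rewrite openE => y [p Dp py].
  apply: filterS (open_nbhs_nbhs (conj (mball_open p _) py)) => z /= pz.
  by exists p.
move=> x A /cmetric_nbhsP[e e0 eA].
have e2 : 0 < e / 2 by rewrite divr_gt0.
have [N _ /(_ _ (leqnn _)) /= Ne] := near_infty_natSinv_lt (PosNum e2).
have N0 : (0 : R) < N.+1%:R^-1 by rewrite invr_gt0.
have [|p [/= xp Dp]] := dD [set y | d x y < N.+1%:R^-1] _ (mball_open _ _).
  by exists x; rewrite /= cmetric_refl.
exists (pickle (k p, N)); rewrite pickleK; split.
  by exists p => //; rewrite cmetric_sym.
move=> y [q [Dq kqp] qy]; apply: eA => /=.
have qp : q = p by apply: kD => //; rewrite inE.
rewrite {}qp in qy.
apply: le_lt_trans (cmetric_triangle x p y) _.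
by rewrite (splitr e); apply: ltrD; exact: lt_trans Ne.
Qed.

End metric.

Section polish.
Context {R : realType}.

Lemma polish_base (T : topologicalType) :
  polish R T -> exists B : nat -> set T, open_base B.
Proof. by case=> sT [d dT _]; exact: cmetric_base dT sT. Qed.

Lemma polish_hausdorff (T : topologicalType) : polish R T -> hausdorff_space T.
Proof. by case=> _ [d dT _]; exact: cmetric_hausdorff dT. Qed.

(** The Baire category theorem; [F] is a total choice of the next smaller open set, with a junk
    value on sets that are empty or not open. *)
Lemma comeager_dense (T : topologicalType) (A : set T) :
  polish R T -> comeager A -> dense A.
Proof.
case=> sT [d dT dC] /comeagerP[ O [oO dO OA]] N N0 oN.
have /choice[F FP] : forall nU : nat * set T, exists V, open nU.2 -> nU.2 !=set0 ->
    [/\ open V, V !=set0, closure V `<=` nU.2 `&` O nU.1 &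
      forall y z, V y -> V z -> d y z < nU.1.+1%:R^-1].
  move=> [n U] /=; have [[oU U0]|nU] := pselect (open U /\ U !=set0); last first.
    by exists set0 => ? ?; case: nU.
  have [x [Ux Ox]] := dO n U U0 oU.
  have n0 : (0 : R) < n.+1%:R^-1 by rewrite invr_gt0.
  have [V [? ? ? ?]] := mball_shrink dT (openI oU (oO n)) (conj Ux Ox) n0.
  by exists V => _ _; split=> //; exists x.
pose U := fix U n := if n is m.+1 then F (m, U m) else N.
have U1 n : open (U n) /\ U n !=set0.
  by elim: n => [//|n [oU U0]] /=; have [] := FP (n, U n) oU U0.
have U2 n : closure (U n.+1) `<=` U n `&` O n.
  by have [oU U0] := U1 n; have [] := FP (n, U n) oU U0.
have /choice[p pU] : forall n, exists p, U n p by move=> n; have [_] := U1 n.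
have [||l [Ul _]] := nested_limit dC pU.
- by move=> n x /U2[].
- by move=> n; have [oU U0] := U1 n; have [_ _ _] := FP (n, U n) oU U0.
exists l; split; first exact: (Ul 0%N).
by apply: OA => n _; have /subset_closure/U2[] := Ul n.+1.
Qed.

Lemma polish_prod (S T : topologicalType) :
  polish R S -> polish R T -> polish R (S * T)%type.
Proof.
move=> [[C cC dnC] [c cS cC']] [[D cD dnD] [d dT dC']]; split.
  exists (C `*` D); first exact: countableX.
  move=> O [[x y] Oxy] oO.
  have [[A B] [/= + +] ABO] := open_nbhs_nbhs (conj oO Oxy).
  rewrite !nbhsE => -[A' [oA' Ax] AA'] -[B' [oB' By] BB'].
  have [|a [A'a Ca]] := dnC A' _ oA'; first by exists x.
  have [|b [B'b Db]] := dnD B' _ oB'; first by exists y.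
  exists (a, b); split => //; apply: ABO; split; [exact: AA'|exact: BB'].
pose m (p q : S * T) := Num.max (c p.1 q.1) (d p.2 q.2).
exists m; last first.
  move=> u mu.
  have [|x ux] := cC' (fst \o u).
    move=> e /mu[N NP]; exists N => i j Ni Nj /=.
    by have := NP i j Ni Nj; rewrite /m gt_max => /andP[].
  have [|y uy] := dC' (snd \o u).
    move=> e /mu[N NP]; exists N => i j Ni Nj /=.
    by have := NP i j Ni Nj; rewrite /m gt_max => /andP[].
  exists (x, y).
  have -> : u = (fun n => ((fst \o u) n, (snd \o u) n)).
    by apply/funext => n /=; case: (u n).
  exact: cvg_pair.
split; first split.
- by move=> x y; rewrite /m le_max (cmetric_ge0 cS).
- move=> [x y] [x' y']; rewrite /m /=; split=> [|[<- <-]]; last first.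
    by rewrite (cmetric_refl cS) (cmetric_refl dT) maxxx.
  have := cmetric_ge0 cS x x'; have := cmetric_ge0 dT y y' => dy cx m0.
  have cm : c x x' <= 0 by rewrite -m0 le_max lexx.
  have dm : d y y' <= 0 by rewrite -m0 le_max lexx orbT.
  congr pair; [apply: (cmetric_eq0 cS)|apply: (cmetric_eq0 dT)].
    by apply/eqP; rewrite eq_le cm.
  by apply/eqP; rewrite eq_le dm.
- by move=> x y; rewrite /m (cmetric_sym cS) (cmetric_sym dT).
- move=> x y z; rewrite /m ge_max; apply/andP; split.
    apply: le_trans (cmetric_triangle cS _ y.1 _) _.
    by apply: lerD; rewrite le_max lexx.
  apply: le_trans (cmetric_triangle dT _ y.2 _) _.
  by apply: lerD; rewrite le_max lexx orbT.
move=> [x y] A; split=> [[[U V] [/= + +] UVA]|[e e0 eA]].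
  move=> /(cmetric_nbhsP cS)[e e0 eU] /(cmetric_nbhsP dT)[e' e'0 e'V].
  exists (Num.min e e'); first by rewrite lt_min e0.
  move=> [x' y']; rewrite /m /= gt_max !lt_min => /andP[/andP[? ?] /andP[? ?]].
  by apply: UVA; split; [exact: eU|exact: e'V].
exists ([set x' | c x x' < e], [set y' | d y y' < e]) => /=.
  by split; [exact: mball_nbhs cS _ _ e0|exact: mball_nbhs dT _ _ e0].
move=> [x' y'] [/= cx dy]; apply: eA.
by rewrite /m /= gt_max cx.
Qed.

End polish.

(** * Right-invariant metrics *)

Section topological_group.
Context {G : topologicalGroupType}.
Implicit Types g h k : G.

Lemma cvg_mulg (S : Type) (F : set_system S) {FF : Filter F} (a b : S -> G) g h :
  a @ F --> g -> b @ F --> h -> (a z * b z)%g @[z --> F] --> (g * h)%g.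
Proof.
move=> ag bh; apply: (@cvg_comp _ _ _ (fun z => (a z, b z))
  (fun p => p.1 * p.2)%g _ (nbhs (g, h))); first exact: cvg_pair.
exact: (@mulg_continuous G (g, h)).
Qed.

Lemma cvg_invg (S : Type) (F : set_system S) {FF : Filter F} (a : S -> G) g :
  a @ F --> g -> (a z)^-1%g @[z --> F] --> g^-1%g.
Proof.
move=> ag; apply: (@cvg_comp _ _ _ a (fun z => z^-1)%g _ (nbhs g)) => //.
exact: (@invg_continuous G g).
Qed.

Lemma mulg_continuous_r g : continuous (fun h => h * g)%g.
Proof. by move=> h; apply: cvg_mulg; [exact: cvg_id|exact: cvg_cst]. Qed.

Lemma nbhs1_cube (U : set G) : nbhs 1%g U -> exists2 V : set G, nbhs 1%g V &
  (forall g, V g -> V g^-1%g) /\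
  (forall g h k, V g -> V h -> V k -> U (g * (h * k))%g).
Proof.
have sq (A : set G) : nbhs 1%g A -> exists2 B : set G, nbhs 1%g B &
    forall g h, B g -> B h -> A (g * h)%g.
  rewrite -{1}(mulg1 1%g) => /(@mulg_continuous G (1%g, 1%g))[[B C] [/= B1 C1] BC].
  exists (B `&` C) => [|g h [Bg _] [_ Ch]]; first exact: filterI.
  exact: (BC (g, h)).
move=> /sq[A A1 AU]; have /sq[B B1 BA] := A1.
pose C := A `&` B; have C1 : nbhs 1%g C by exact: filterI.
exists (C `&` [set g | C g^-1%g]).
  apply: filterI => //.
  have : (g^-1)%g @[g --> (1%g : G)] --> (1^-1)%g by exact: invg_continuous.
  by rewrite invg1; apply.
split=> [g [Cg CVg]|g h k [[Ag _] _] [[_ Bh] _] [[_ Bk] _]].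
  by split=> //=; rewrite invgK.
by apply: AU => //; exact: BA.
Qed.

Section chains.
Context {R : realType} (V : nat -> set G).
Hypotheses (V0 : V 0%N = setT) (V1 : forall n, nbhs 1%g (V n)).
Hypothesis VV : forall n g, V n g -> V n g^-1%g.
Hypothesis V3 : forall n g h k, V n.+1 g -> V n.+1 h -> V n.+1 k ->
  V n (g * (h * k))%g.

Fixpoint chain_in (s : seq (G * nat)) : Prop :=
  if s is (g, n) :: s' then V n g /\ chain_in s' else True.

Definition chain_prod (s : seq (G * nat)) : G := foldr (fun p g => p.1 * g)%g 1%g s.

Definition chain_weight (s : seq (G * nat)) : R :=
  foldr (fun p r => 2^-1 ^+ p.2 + r) 0 s.

(** The Birkhoff-Kakutani length: a factor from [V n] costs [2^-n], and the cheapest factorization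
    counts. Since [V 0] is everything, each element has a factorization. *)
Definition chain_norm g : R :=
  inf [set chain_weight s | s in [set s | chain_in s /\ chain_prod s = g]].

Lemma chain_in_cat s t : chain_in (s ++ t) <-> chain_in s /\ chain_in t.
Proof.
elim: s => [|[g n] s IH] /=; first by split=> [|[]].
by split=> [[? /IH[]]|[[? ?] ?]]; split=> //; exact/IH.
Qed.

Lemma chain_prod_cat s t : chain_prod (s ++ t) = (chain_prod s * chain_prod t)%g.
Proof. by elim: s => [|p s IH] /=; rewrite ?mul1g// IH mulgA. Qed.

Lemma chain_weight_cat s t : chain_weight (s ++ t) = chain_weight s + chain_weight t.
Proof. by elim: s => [|p s IH] /=; rewrite ?add0r// IH addrA. Qed.

Lemma chain_weight_ge0 s : 0 <= chain_weight s.
Proof. by elim: s => //= p s IH; rewrite addr_ge0// exprn_ge0. Qed.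

(** For the induction, [t] carries the weight already passed. The pivot [p] is the first factor that
    brings the running total to [c], or the last factor if none does. *)
Lemma chain_split c t s : s != [::] -> 0 < c -> t < c -> t + chain_weight s < c + c ->
  exists s1 p s2, [/\ s = s1 ++ p :: s2, t + chain_weight s1 < c & chain_weight s2 < c].
Proof.
move=> + c0; elim: s t => // p s IH t _ tc /= ts.
have [tp|tp] := ltP (t + 2^-1 ^+ p.2) c; last first.
  by exists [::], p, s; rewrite /= addr0; split=> //; lra.
have [s0|s0] := eqVneq s [::].
  by exists [::], p, s; rewrite s0 /= addr0.
have [|s1 [q [s2 [-> ts1 s2c]]]] := IH _ s0 tp; first by rewrite -addrA.
by exists (p :: s1), q, s2; split=> //=; rewrite addrA.
Qed.

Lemma V_decr n : V n.+1 `<=` V n.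
Proof.
move=> g Vg; rewrite -(mulg1 g) -(mulg1 1%g).
by apply: V3 => //; exact: nbhs_singleton.
Qed.

Lemma V_le m n : (m <= n)%N -> V n `<=` V m.
Proof.
move=> /subnK <-; elim: (n - m)%N => // k IH.
by rewrite addSn; apply: subset_trans IH; exact: V_decr.
Qed.

(* Frink's chain lemma: cut a chain of weight less than 2^-n where half of
   that weight is exceeded, so that both sides satisfy the claim for n + 1. *)
Lemma chain_weight_lt s n : chain_in s -> chain_weight s < 2^-1 ^+ n ->
  V n (chain_prod s).
Proof.
elim: {s}(size s) {-2}s (leqnn (size s)) n => [|m IH] s sm n sV sn.
  by move: sm; rewrite leqn0 => /nilP -> /=; exact: nbhs_singleton.
have [->|s0] := eqVneq s [::]; first exact: nbhs_singleton.
have hn : 0 < 2^-1 ^+ n.+1 :> R by rewrite exprn_gt0.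
have [|s1 [[g k] [s2 [sE]]]] := chain_split s0 hn hn (t := 0).
  by rewrite add0r; move: sn; rewrite exprS; lra.
rewrite add0r => s1n s2n.
have [s1V [gV s2V]] : chain_in s1 /\ V k g /\ chain_in s2.
  by move: sV; rewrite sE => /chain_in_cat.
have ss : (size s1 + size s2 <= m)%N by move: sm; rewrite sE size_cat /= addnS.
rewrite sE chain_prod_cat /=; apply: V3.
- by apply: IH => //; exact: leq_trans (leq_addr _ _) ss.
(* The pivot alone weighs less than [2^-n], so [n < k] and it lies in [V n.+1] like the two outer
   products. *)
- apply: V_le gV; rewrite -(@ltr_iXn2l R 2^-1) ?invr_gt0 ?invf_lt1 ?ltr1n//.
  apply: le_lt_trans sn; rewrite sE chain_weight_cat /= addrCA lerDl.
  by rewrite addr_ge0 ?chain_weight_ge0.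
- by apply: IH => //; exact: leq_trans (leq_addl _ _) ss.
Qed.

Lemma chain_norm_le s : chain_in s -> chain_norm (chain_prod s) <= chain_weight s.
Proof.
move=> sV; apply: ge_inf; last by exists s.
by exists 0 => _ [t _ <-]; exact: chain_weight_ge0.
Qed.

Lemma chain_norm_lt g c : chain_norm g < c ->
  exists s, [/\ chain_in s, chain_prod s = g & chain_weight s < c].
Proof.
move=> /inf_lt[|_ [s [sV sg] <-] sc]; last by exists s.
by exists (chain_weight [:: (g, 0%N)]), [:: (g, 0%N)] => //=; rewrite V0 mulg1.
Qed.

Lemma chain_norm_ge0 g : 0 <= chain_norm g.
Proof.
apply: lb_le_inf => [|_ [t _ <-]]; last exact: chain_weight_ge0.
by exists (chain_weight [:: (g, 0%N)]), [:: (g, 0%N)] => //=; rewrite V0 mulg1.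
Qed.

Lemma chain_norm1 : chain_norm 1%g = 0.
Proof. by apply/eqP; rewrite eq_le chain_norm_ge0 (@chain_norm_le [::]). Qed.

Lemma chain_norm_V n g : V n g -> chain_norm g <= 2^-1 ^+ n.
Proof.
move=> gV; have := @chain_norm_le [:: (g, n)].
by rewrite /= mulg1 addr0; apply.
Qed.

Lemma V_chain_norm n g : chain_norm g < 2^-1 ^+ n -> V n g.
Proof. by move=> /chain_norm_lt[s [sV <- sn]]; exact: chain_weight_lt. Qed.

Lemma chain_normM g h : chain_norm (g * h)%g <= chain_norm g + chain_norm h.
Proof.
apply/ler_addgt0Pr => e e0; have e2 : 0 < e / 2 by rewrite divr_gt0.
have [s [sV sg se]] : exists s, [/\ chain_in s, chain_prod s = g &
    chain_weight s < chain_norm g + e / 2].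
  by apply: chain_norm_lt; rewrite ltrDl.
have [t [tV th te]] : exists t, [/\ chain_in t, chain_prod t = h &
    chain_weight t < chain_norm h + e / 2].
  by apply: chain_norm_lt; rewrite ltrDl.
rewrite -sg -th -chain_prod_cat; apply: le_trans (chain_norm_le _) _.
  exact/chain_in_cat.
by rewrite chain_weight_cat sg th; lra.
Qed.

Lemma chain_normV_le g : chain_norm g^-1%g <= chain_norm g.
Proof.
have rv s : chain_in s -> exists t, [/\ chain_in t,
    chain_prod t = (chain_prod s)^-1%g & chain_weight t = chain_weight s].
  elim: s => [|[h n] s IH] /=; first by exists [::]; rewrite /= invg1.
  move=> [hV /IH[t [tV ts tw]]]; exists (rcons t (h^-1%g, n)).
  rewrite -cats1 chain_prod_cat chain_weight_cat /= ts tw invgM mulg1 addr0 addrC.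
  by split=> //; apply/chain_in_cat; split=> //=; split=> //; exact: VV.
apply/ler_addgt0Pr => e e0.
have [s [/rv[t [tV ts tw]] sg se]] : exists s, [/\ chain_in s, chain_prod s = g &
    chain_weight s < chain_norm g + e].
  by apply: chain_norm_lt; rewrite ltrDl.
rewrite -sg -ts; apply: le_trans (chain_norm_le tV) _.
by rewrite tw sg ltW.
Qed.

End chains.

(** The Polish metric [r] makes the [V n] a base at 1: [V n.+1] is symmetric, its triple products
    lie in [V n], and it is inside the [r]-ball of radius [1/(n+1)]. The resulting metric
    [N (g * h^-1)] need not be complete. *)
Lemma birkhoff_kakutani (R : realType) : polish R G ->
  exists2 d : G -> G -> R, compatible_metric d & right_invariant d.
Proof.
move=> [_ [r rG _]].
have /choice[F FP] : forall nU : nat * set G, exists V : set G, nbhs 1%g nU.2 ->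
    [/\ nbhs 1%g V, V `<=` [set g | r 1%g g < nU.1.+1%:R^-1],
    forall g, V g -> V g^-1%g &
    forall g h k, V g -> V h -> V k -> nU.2 (g * (h * k))%g].
  move=> [n U] /=; have [U1|U1] := pselect (nbhs 1%g U); last by exists set0.
  have n0 : (0 : R) < n.+1%:R^-1 by rewrite invr_gt0.
  have [V V1 [VV VU]] := nbhs1_cube (filterI U1 (mball_nbhs rG 1%g n0)).
  exists V => _; split=> // [g Vg|g h k Vg Vh Vk].
    have [_] := VU _ _ _ Vg (nbhs_singleton V1) (nbhs_singleton V1).
    by rewrite !mulg1.
  by have [] := VU _ _ _ Vg Vh Vk.
pose V := fix V n : set G := if n is m.+1 then F (m, V m) else setT.
have V1 n : nbhs 1%g (V n).
  by elim: n => [|n IH]; [exact: filterT|have [] := FP (n, V n) IH].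
have VV n g : V n g -> V n g^-1%g.
  by case: n => // n; have [_ _] := FP (n, V n) (V1 n); move=> /[swap] _; apply.
have V3 n g h k : V n.+1 g -> V n.+1 h -> V n.+1 k -> V n (g * (h * k))%g.
  by have [_ _ _] := FP (n, V n) (V1 n); apply.
have Vr n g : V n.+1 g -> r 1%g g < n.+1%:R^-1.
  by have [_ + _ _] := FP (n, V n) (V1 n); apply.
have V0 : V 0%N = setT by [].
pose N := chain_norm (R := R) V.
have NV n g : N g < 2^-1 ^+ n -> V n g by exact: V_chain_norm V0 V1 V3 _ _.
have VN n g : V n g -> N g <= 2^-1 ^+ n by exact: chain_norm_V.
have N1 : N 1%g = 0 := chain_norm1 V0.
have NVg g : N g^-1%g = N g.
  apply/eqP; rewrite eq_le chain_normV_le//= -{1}(invgK g).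
  exact: chain_normV_le.
have base (A : set G) : nbhs 1%g A -> exists n, V n `<=` A.
  move=> /(cmetric_nbhsP rG)[e e0 eA].
  have [n _ /(_ _ (leqnn _)) /= ne] := near_infty_natSinv_lt (PosNum e0).
  by exists n.+1 => g /Vr gn; apply: eA; exact: lt_trans ne.
exists (fun g h => N (g * h^-1)%g); last first.
  by move=> g h k; rewrite /= invgM mulgA -(mulgA g) mulgV mulg1.
split; first split.
- by move=> g h; exact: chain_norm_ge0.
- move=> g h; split=> [gh|->]; last by rewrite mulgV.
  suff : (g * h^-1)%g = 1%g by move=> e; rewrite -(mulgVK h g) e mul1g.
  apply: contrapT => gh1.
  have /base[n nP] : nbhs 1%g [set k | k <> (g * h^-1)%g].
    have r0 : 0 < r 1%g (g * h^-1)%g.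
      rewrite lt_neqAle (cmetric_ge0 rG) andbT eq_sym.
      by apply/eqP => /(cmetric_eq0 rG) e; apply: gh1.
    apply: filterS (mball_nbhs rG 1%g r0) => k /= + e.
    by rewrite e ltxx.
  have /nP/(_ erefl) : V n (g * h^-1)%g by apply: NV; rewrite gh exprn_gt0.
  by [].
- by move=> g h; rewrite -NVg invgM invgK.
- move=> g h k; have -> : (g * k^-1 = (g * h^-1) * (h * k^-1))%g.
    by rewrite mulgA mulgVK.
  exact: chain_normM.
move=> x A; split=> [xA|[e e0 eA]].
  have /base[n nA] : nbhs 1%g [set k | A (k^-1 * x)%g].
    have : (k^-1 * x)%g @[k --> (1%g : G)] --> (1^-1 * x)%g.
      by apply: cvg_mulg; [apply: cvg_invg; exact: cvg_id|exact: cvg_cst].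
    by rewrite invg1 mul1g; apply.
  exists (2^-1 ^+ n) => [|y /= /NV/nA /=]; first by rewrite exprn_gt0.
  by rewrite invgM invgK mulgVK.
have [n _ /(_ _ (leqnn _)) /= ne] := near_infty_natSinv_expn_lt (PosNum e0).
rewrite div1r -exprVn in ne.
have : nbhs x [set y | V n (x * y^-1)%g].
  have : (x * y^-1)%g @[y --> x] --> (x * x^-1)%g.
    by apply: cvg_mulg; [exact: cvg_cst|apply: cvg_invg; exact: cvg_id].
  by rewrite mulgV; apply.
apply: filterS => y /= /VN yn; apply: eA => /=.
exact: le_lt_trans ne.
Qed.

End topological_group.

(** * The Baire property and uniformization *)

(** The points at which [A] is of second category; the complement is the union of all open sets in
    which [A] is meager. *)
Definition nonmeager_at (T : topologicalType) (A : set T) : set T :=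
  [set x | ~ exists2 N : set T, open N /\ N x & \forall* z, N z -> ~ A z].

Definition almost_open (T : topologicalType) (A : set T) :=
  exists2 U : set T, open U & \forall* z, A z <-> U z.

Section baire_property.
Context {T : topologicalType}.
Implicit Types A N : set T.

Lemma baire_measurableP A : baire_measurable A <-> almost_open A.
Proof.
have E (U : set T) : A `+` U = ~` [set z | A z <-> U z].
  apply/seteqP; split=> [z [[Az Uz]|[Uz Az]]|z /= AU].
  - by move=> /= [/(_ Az)].
  - by move=> /= [_ /(_ Uz)].
  - have [Az|Az] := pselect (A z); have [Uz|Uz] := pselect (U z).
    + by exfalso; apply: AU.
    + by left.
    + by right.
    + by exfalso; apply: AU; split.
by split=> -[U oU mU]; exists U => //; move: mU; rewrite E /comeager /mkset.
Qed.

Lemma closed_nonmeager_at A : closed (nonmeager_at A).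
Proof.
move=> x clx [N [oN Nx] NA].
have [y [Ay Ny]] := clx _ (open_nbhs_nbhs (conj oN Nx)).
by apply: Ay; exists N.
Qed.

Lemma nonmeager_at_closure A : nonmeager_at A `<=` closure A.
Proof.
move=> x Ax N; rewrite nbhsE => -[U [oU Ux] UN].
apply: contrapT => AN; apply: Ax; exists U => //.
by apply: filterE => z Uz Az; apply: AN; exists z; split => //; exact: UN.
Qed.

(** The open sets in which [A] is meager are covered by countably many basic ones. *)
Lemma nonmeager_at_comeager (B : nat -> set T) A :
  open_base B -> \forall* z, A z -> nonmeager_at A z.
Proof.
move=> [oB BP].
have : \forall* z, forall n, (\forall* z, B n z -> ~ A z) -> B n z -> ~ A z.
  apply: comeager_forall => n.
  have [h|h] := pselect (\forall* z, B n z -> ~ A z); last by apply: filterE.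
  by apply: filterS h => z h _.
apply: filterS => z H Az [N [oN Nz] NA].
have [n [Bnz BnN]] := BP _ _ (open_nbhs_nbhs (conj oN Nz)).
apply: (H n) => //; apply: filterS NA => y /= NA /BnN; exact: NA.
Qed.

(** [W] is dense: if an open [N] misses the interiors of all the closed sets [nonmeager_at (F n)],
    then every [F n] is meager in [N], hence so is [A], and [N] misses [nonmeager_at A]. *)
Lemma nonmeager_at_bigcup (B : nat -> set T) A (F : nat -> set T) :
  open_base B -> A `<=` \bigcup_n F n ->
  \forall* z, nonmeager_at A z -> exists n, nonmeager_at (F n) z.
Proof.
move=> baseB AF; pose W := (\bigcup_n (nonmeager_at (F n))°) `|` ~` nonmeager_at A.
apply: (@filterS _ _ _ W) => [z [[n _ /interior_subset Fn] _|nA /= /nA[]]|].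
  by exists n.
apply: comeager_open_dense.
  apply: openU; first by apply: bigcup_open => n _; exact: open_interior.
  exact/closed_openC/closed_nonmeager_at.
move=> N [x Nx] oN; apply: contrapT => NW; apply: (NW).
have NF n y : N y -> ~ (nonmeager_at (F n))° y.
  by move=> Ny Fy; apply: NW; exists y; split => //; left; exists n.
exists x; split=> //; right; apply => //; exists N => //.
have H1 : \forall* z, forall n, nonmeager_at (F n) z -> (nonmeager_at (F n))° z.
  by apply: comeager_forall => n; exact/comeager_interior/closed_nonmeager_at.
have H2 : \forall* z, forall n, F n z -> nonmeager_at (F n) z.
  by apply: comeager_forall => n; exact: nonmeager_at_comeager baseB.
apply: filterS2 H1 H2 => z H1 H2 Nz /AF[n _ /H2/H1]; exact: NF.
Qed.

Lemma nonmeager_at0 : nonmeager_at (@set0 T) = set0.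
Proof.
apply/seteqP; split=> // x; apply; exists setT; first by split => //; exact: openT.
by apply: filterE => y _ [].
Qed.

End baire_property.

Lemma open_section_r (S T : topologicalType) (O : set (S * T)) (x : S) :
  open O -> open [set y | O (x, y)].
Proof.
move=> oO; apply: (@open_comp _ _ (fun y => (x, y))) oO => y _.
by apply: cvg_pair; [exact: cvg_cst|exact: cvg_id].
Qed.

Lemma open_section_l (S T : topologicalType) (O : set (S * T)) (y : T) :
  open O -> open [set x | O (x, y)].
Proof.
move=> oO; apply: (@open_comp _ _ (fun x => (x, y))) oO => x _.
by apply: cvg_pair; [exact: cvg_id|exact: cvg_cst].
Qed.

Lemma open_rectangle (S T : topologicalType) (U : set S) (V : set T) :
  open U -> open V -> open (U `*` V).
Proof.
move=> oU oV; rewrite openE => -[x y] [/= Ux Vy]; exists (U, V) => //.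
by split; exact: open_nbhs_nbhs.
Qed.

(** For a dense open set, the [y] whose section meets a given nonempty [B i] form a dense open set;
    meeting all of these makes the section dense. *)
Lemma kuratowski_ulam (S T : topologicalType) (B : nat -> set S) (E : set (S * T)) :
  open_base B -> comeager E -> \forall* y, \forall* x, E (x, y).
Proof.
move=> [oB BP] /comeagerP[ O [oO dO OE]].
have H n : \forall* y, forall i, B i !=set0 -> exists2 x, B i x & O n (x, y).
  apply: comeager_forall => i; have [[x0 Bx0]|B0] := pselect (B i !=set0); last first.
    by apply: filterE => y /B0.
  have oW : open (\bigcup_(x in B i) [set y | O n (x, y)]).
    by apply: bigcup_open => x _; exact: open_section_r.
  apply: filterS (comeager_open_dense oW _) => [y [x Bx Oxy] _|N [y Ny] oN].
    by exists x.
  have [||[a b] [[/= Ba Nb] Oab]] := dO n (B i `*` N); last by exists b; split=> //; exists a.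
  - by exists (x0, y).
  - exact: open_rectangle.
apply: filterS (comeager_forall H) => y Hy.
have : \forall* x, forall n, O n (x, y).
  apply: comeager_forall => n; apply: comeager_open_dense.
    exact: open_section_l.
  move=> N [x Nx] oN; have [i [Bx BN]] := BP _ _ (open_nbhs_nbhs (conj oN Nx)).
  have [|z Bz Oz] := Hy n i; first by exists x.
  by exists z; split=> //; exact: BN.
by apply: filterS => x Ox; apply: OE => n _; exact: Ox.
Qed.

Definition continuous_on (S T : topologicalType) (D : set S) (f : S -> T) :=
  forall x, D x -> forall A, nbhs (f x) A -> nbhs x [set y | D y -> A (f y)].

Section uniformization.
Context {R : realType} {P Z : topologicalType}.
Variables (F : set P) (O : nat -> set P) (phi : P -> Z).
Hypotheses (F_closed : closed F) (O_open : forall n, open (O n)).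

Let S := F `&` \bigcap_n O n.

(* Every z where phi(S) is locally nonmeager has, off a meager set, a nested
   sequence of shrinking basic sets B whose images phi(B n S) are all nonmeager
   at z; it closes down to a preimage of z. Taking least indices makes the
   sequence locally constant in z off the boundaries of the countably many closed
   sets K i, which gives continuity. *)
Lemma uniformization (x0 : P) : polish R P -> polish R Z -> continuous_on S phi ->
  exists (s : Z -> P) (C : set Z),
    [/\ comeager C,
        forall z, C z -> nonmeager_at (phi @` S) z -> S (s z) /\ phi (s z) = z &
        continuous_on (C `&` nonmeager_at (phi @` S)) s].
Proof.
move=> pP pZ phiS; have [B0 [oB0 B0P]] := polish_base pP.
have [BZ BZP] := polish_base pZ; have hZ := polish_hausdorff pZ.
case: pP => _ [d dP dC].
(* Index 0 stands for the whole space: every code starts there, and [K 0] is the set over which a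
   section is sought. *)
pose B i := if i is j.+1 then B0 j else setT.
have oB i : open (B i) by case: i => [|i]; [exact: openT|exact: oB0].
pose K i := nonmeager_at (phi @` (B i `&` S)).
pose succ n i j := closure (B j) `<=` B i `&` O n /\
  forall y z, B j y -> B j z -> d y z < n.+1%:R^-1.
have K0 : nonmeager_at (phi @` S) = K 0%N by rewrite /K setTI.
rewrite K0.
have KS n i : \forall* z, K i z -> exists j, succ n i j /\ K j z.
  pose A j := if `[< succ n i j >] then phi @` (B j `&` S) else set0.
  apply: filterS (nonmeager_at_bigcup (F := A) BZP _) => [z Kz /Kz[j]|].
    rewrite /A; case: asboolP => sj; last by rewrite nonmeager_at0.
    by exists j.
  move=> _ [p [Bp Sp] <-].
  have n0 : (0 : R) < n.+1%:R^-1 by rewrite invr_gt0.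
  have [U [oU Up clU diamU]] := mball_shrink dP (openI (oB i) (O_open n))
    (conj Bp (Sp.2 n I)) n0.
  have [j [Bj jU]] := B0P _ _ (open_nbhs_nbhs (conj oU Up)).
  exists j.+1 => //; rewrite /A asboolT; first by exists p.
  split=> [|y z /jU Uy /jU Uz]; last exact: diamU.
  by apply: subset_trans clU; exact: closure_subset.
pose cand z n i j := `[< succ n i j /\ K j z >].
pose next z n i := if pselect (exists j, cand z n i j) is left e then ex_minn e else 0%N.
pose code z := fix code n := if n is m.+1 then next z m (code m) else 0%N.
pose C := [set z | forall n i, K i z -> exists j, succ n i j /\ K j z] `&`
  [set z | forall i, K i z -> (K i)° z].
have cC : comeager C.
  apply: filterI.
    by apply: comeager_forall => n; apply: comeager_forall => i; exact: KS.
  apply: comeager_forall => i; exact/comeager_interior/closed_nonmeager_at.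
have nextP z n i : C z -> K i z -> succ n i (next z n i) /\ K (next z n i) z.
  move=> [Cz _] /(Cz n)[j jP]; rewrite /next; case: pselect => [e|[]].
    by case: ex_minnP => k /asboolP.
  by exists j; exact/asboolP.
have codeK z n : C z -> K 0%N z -> K (code z n) z.
  by move=> Cz Kz; elim: n => //= n IH; have [] := nextP z n _ Cz IH.
have codeS z n : C z -> K 0%N z -> succ n (code z n) (code z n.+1).
  by move=> Cz Kz; have [] := nextP z n _ Cz (codeK z n Cz Kz).
pose lim z := [set l | [/\ S l, phi l = z & forall n, B (code z n) l]].
have limP z : C z -> K 0%N z -> exists l, lim z l.
  move=> Cz Kz.
  have /choice[p pP] : forall n, exists p, (B (code z n) `&` S) p.
    move=> n; have /nonmeager_at_closure := codeK z n Cz Kz.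
    by move=> /(_ setT filterT)[_ [[p ? _] _]]; exists p.
  have [||n y t|l [Bl pl]] := @nested_limit R P d (fun n => B (code z n)) p dC.
  - by move=> n; have [] := pP n.
  - by move=> n x /((codeS z n Cz Kz).1)[].
  - exact: (codeS z n Cz Kz).2.
  have Sl : S l.
    split.
      apply: F_closed => A /pl[N _ /(_ _ (leqnn _)) NA].
      by exists (p N); split=> //; have [_ []] := pP N.
    by move=> n _; have /subset_closure/((codeS z n Cz Kz).1)[] := Bl n.+1.
  (* That [phi l = z] holds because [z] is in the closure of the image of each [B (code z n)], while
     these sets shrink to [l], where [phi] is continuous relative to [S]. *)
  exists l; split=> //; apply: hZ => M N phM zN.
  have /(cmetric_nbhsP dP)[e e0 eM] := phiS l Sl _ phM.
  have [n _ /(_ _ (leqnn _)) /= ne] := near_infty_natSinv_lt (PosNum e0).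
  have /nonmeager_at_closure/(_ _ zN)[_ [[q [Bq Sq] <-] Nq]] := codeK z n.+1 Cz Kz.
  exists (phi q); split=> //; apply: (eM q) => //=.
  apply: lt_trans ne; exact: ((codeS z n Cz Kz).2 _ _ (Bl n.+1) Bq).
exists (fun z => xget x0 (lim z)), C; split=> // [z Cz Kz|z [Cz Kz] N].
  by have [] := xgetPex x0 (limP z Cz Kz).
have [_ _ Bs] := xgetPex x0 (limP z Cz Kz).
move=> /(cmetric_nbhsP dP)[e e0 eN].
have [n _ /(_ _ (leqnn _)) /= ne] := near_infty_natSinv_lt (PosNum e0).
have code_near m : nbhs z [set z' | code z' m = code z m].
  elim: m => [|m IH] /=; first by apply: filterE.
  set i := code z m; set j := next z m i.
  have [sj Kj] : succ m i j /\ K j z by apply: nextP => //; exact: codeK.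
  have jmin k : (k < j)%N -> ~ (succ m i k /\ K k z).
    rewrite /j /next; case: pselect => // ex; case: ex_minnP => l _ lmin kl kP.
    by have := lmin k (asboolT kP); rewrite leqNgt kl.
  (* Only finitely many indices precede [j], and each stays rejected near [z] because [K k] is
     closed. The index [j] itself stays accepted because [z] is interior to [K j]. *)
  have jmin_near k : (k <= j)%N ->
      nbhs z [set z' | forall l, (l < k)%N -> ~ (succ m i l /\ K l z')].
    elim: k => [|k IHk] kj; first by apply: filterE.
    have : nbhs z [set z' | ~ (succ m i k /\ K k z')].
      have [sk|sk] := pselect (succ m i k); last by apply: filterE => ? [].
      have : nbhs z (~` K k).
        apply: open_nbhs_nbhs; split; first exact/closed_openC/closed_nonmeager_at.
        by move=> Kz'; apply: (jmin k).
      by apply: filterS => z' nK [].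
    move: (IHk (ltnW kj)); apply: filterS2 => z' H Hk l.
    by rewrite ltnS leq_eqVlt => /predU1P[->//|]; exact: H.
  have Kjn : nbhs z (K j) by apply: Cz.2.
  apply: filterS3 IH (jmin_near j (leqnn _)) Kjn => z' /= -> z'min Kjz'.
  rewrite -/i /next; case: pselect => [ex|[]]; last first.
    by exists j; exact/asboolP.
  case: ex_minnP => l /asboolP lP lmin; apply/eqP; rewrite eqn_leq lmin ?andTb.
    by rewrite leqNgt; apply/negP => /z'min.
  exact/asboolP.
apply: filterS (code_near n.+1) => z' zz' [Cz' Kz']; apply: eN => /=.
apply: lt_trans ne; have [_ _ Bs'] := xgetPex x0 (limP z' Cz' Kz').
by apply: (codeS z n Cz Kz).2 => //; rewrite -zz'.
Qed.

(** The Baire property of analytic sets. Off a meager set the image lies in its set of local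
    nonmeagerness, and the section gives the converse inclusion. *)
Lemma almost_open_image : polish R P -> polish R Z -> continuous_on S phi ->
  almost_open (phi @` S).
Proof.
move=> pP pZ phiS; have [BZ BZP] := polish_base pZ.
have [[x0 _]|P0] := pselect ([set: P] !=set0); last first.
  exists set0; first exact: open0.
  by apply: filterE => z; split=> // -[x _ _]; apply: P0; exists x.
have [s [C [cC sP _]]] := uniformization x0 pP pZ phiS.
exists (nonmeager_at (phi @` S))°; first exact: open_interior.
have := comeager_interior (@closed_nonmeager_at _ (phi @` S)).
apply: filterS3 cC (nonmeager_at_comeager _ BZP) => z Cz Kz Ki.
split=> [/Kz/Ki//|/interior_subset /(sP z Cz)[Ss <-]].
by exists (s z).
Qed.

End uniformization.

(** * Orbit continuity *)

Section action.
Context {G : topologicalGroupType} {X : topologicalType} (act : G -> X -> X).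
Hypothesis cA : continuous_action act.

Lemma act1 x : act 1%g x = x. Proof. by case: cA. Qed.

Lemma actM g h x : act (g * h)%g x = act g (act h x). Proof. by case: cA. Qed.

Lemma actVK g x : act g^-1%g (act g x) = x.
Proof. by rewrite -actM mulVg act1. Qed.

Lemma actKV g x : act g (act g^-1%g x) = x.
Proof. by rewrite -actM mulgV act1. Qed.

Lemma cvg_act (S : Type) (F : set_system S) {FF : Filter F} (a : S -> G)
    (b : S -> X) g x :
  a @ F --> g -> b @ F --> x -> act (a z) (b z) @[z --> F] --> act g x.
Proof.
move=> ag bx; apply: (@cvg_comp _ _ _ (fun z => (a z, b z))
  (fun p => act p.1 p.2) _ (nbhs (g, x))); first exact: cvg_pair.
by case: cA => _ _ /(_ (g, x)).
Qed.

Lemma act_continuous_l x : continuous (act^~ x).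
Proof. by move=> g; apply: cvg_act; [exact: cvg_id|exact: cvg_cst]. Qed.

Lemma act_continuous_r g : continuous (act g).
Proof. by move=> x; apply: cvg_act; [exact: cvg_cst|exact: cvg_id]. Qed.

Lemma act_open (O : set (G * X)) : open O -> open ((fun p => act p.1 p.2) @` O).
Proof.
move=> oO.
have -> : (fun p => act p.1 p.2) @` O =
    \bigcup_g act g^-1%g @^-1` [set x | O (g, x)].
  apply/seteqP; split=> [_ [[g x] Ox <-]|x [g _ Ox]].
    by exists g => //=; rewrite actVK.
  by exists (g, act g^-1%g x) => //=; rewrite actKV.
apply: bigcup_open => g _; apply: open_comp; last exact: open_section_r.
by move=> ? _; exact: act_continuous_r.
Qed.

(** Together with [kuratowski_ulam] this yields that for generic [x] the point [g x] lies in [C] for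
    generic [g]. *)
Lemma comeager_act_preimage (C : set X) :
  comeager C -> comeager [set p : G * X | C (act p.1 p.2)].
Proof.
move=> cC; apply: (comeager_preimage (f := fun p : G * X => act p.1 p.2)) => //.
- by case: cA.
- exact: act_open.
Qed.

End action.

Lemma comeager_mulg_r (G : topologicalGroupType) (C : set G) (k : G) :
  comeager C -> \forall* g, C (g * k)%g.
Proof.
apply: (@comeager_preimage _ _ (fun g => g * k)%g); first exact: mulg_continuous_r.
move=> O oO; have -> : [set (g * k)%g | g in O] = (fun g => g * k^-1)%g @^-1` O.
  apply/seteqP; split=> [_ [g Og <-]|g /= Og]; first by rewrite /= mulgK.
  by exists (g * k^-1)%g => //; rewrite mulgVK.
by apply: open_comp => // ? _; exact: mulg_continuous_r.
Qed.

Lemma open_snd (S T : topologicalType) (O : set (S * T)) :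
  open O -> open (snd @` O).
Proof.
move=> oO; have -> : snd @` O = \bigcup_x [set y | O (x, y)].
  apply/seteqP; split=> [_ [[x y] Oxy <-]|y [x _ Oxy]]; first by exists x.
  by exists (x, y).
by apply: bigcup_open => x _; exact: open_section_r.
Qed.

Lemma comeager_snd_preimage (S T : topologicalType) (C : set T) :
  comeager C -> comeager [set p : S * T | C p.2].
Proof.
apply: (@comeager_preimage (S * T)%type T snd); last exact: open_snd.
by move=> ?; exact: cvg_snd.
Qed.

Section almost_open.
Context {T : topologicalType}.
Implicit Types A B : set T.

Lemma almost_open_ae A B :
  (\forall* z, A z <-> B z) -> almost_open A -> almost_open B.
Proof.
move=> AB [U oU AU]; exists U => //; apply: filterS2 AB AU => z AB AU.
by split=> [/AB/AU|/AU/AB].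
Qed.

Lemma almost_open_imply A B :
  almost_open A -> almost_open B -> almost_open [set z | A z -> B z].
Proof.
move=> [U oU AU] [V oV BV]; exists (~` closure U `|` V).
  by apply: openU => //; exact/closed_openC/closed_closure.
apply: filterS3 AU BV (comeager_closure oU) => z /= AU BV clU.
split=> [AB|[nU Az|Vz _]].
- have [Uz|nU] := pselect (closure U z); last by left.
  by right; apply/BV/AB/AU/clU.
- by exfalso; apply: nU; apply: subset_closure; exact/AU.
- exact/BV.
Qed.

End almost_open.

Section continuous_on.
Context {S T Z : topologicalType}.

Lemma continuous_on_subset (D E : set S) (f : S -> T) :
  D `<=` E -> continuous_on E f -> continuous_on D f.
Proof.
move=> DE fE x /DE Ex A /(fE x Ex).
by apply: filterS => y AE /DE.
Qed.

Lemma continuous_continuous_on (D : set S) (f : S -> T) :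
  continuous f -> continuous_on D f.
Proof.
move=> cf x _ A fA; have H : nbhs x (f @^-1` A) := cf x A fA.
by apply: filterS H => y Ay _.
Qed.

Lemma continuous_on_comp (D : set S) (E : set T) (f : S -> T) (g : T -> Z) :
  (forall x, D x -> E (f x)) -> continuous_on D f -> continuous_on E g ->
  continuous_on D (g \o f).
Proof.
move=> DE cf cg x Dx A /(cg _ (DE x Dx))/(cf x Dx).
by apply: filterS => y H Dy; apply: (H Dy); exact: DE.
Qed.

Lemma continuous_on_cvg (D : set S) (f : S -> T) (u : nat -> S) (x : S) :
  continuous_on D f -> D x -> (forall n, D (u n)) -> u @ \oo --> x ->
  f (u n) @[n --> \oo] --> f x.
Proof.
move=> cf Dx Du ux A fA.
have H : \forall n \near \oo, D (u n) -> A (f (u n)) := ux _ (cf x Dx A fA).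
by apply: filterS H => n; apply.
Qed.

(** Puts a coincidence set into the form closed set intersected with [D] that [almost_open_image]
    asks for. *)
Lemma continuous_on_eq_closed (D : set S) (u v : S -> T) :
  hausdorff_space T -> continuous_on D u -> continuous_on D v ->
  closure [set x | D x /\ u x = v x] `&` D = [set x | D x /\ u x = v x].
Proof.
move=> hT cu cv; apply/seteqP; split=> [x [clx Dx]|x xE]; last first.
  by split; [exact: subset_closure|case: xE].
split=> //; apply: hT => A B /(cu x Dx) uA /(cv x Dx) vB.
have [y [[Dy uv] [Ay By]]] := clx _ (filterI uA vB).
by exists (u y); split; [exact: Ay|rewrite uv; exact: By].
Qed.

End continuous_on.

(** Dependent choice with access to the full history, so that each new term can be generic relative
    to all earlier ones. *)
Lemma history_choice (T : Type) (P : seq T -> T -> Prop) :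
  (forall s, exists t, P s t) -> exists u : nat -> T, forall n, P (mkseq u n) (u n).
Proof.
move=> /choice[F FP].
pose L := fix L n := if n is m.+1 then rcons (L m) (F (L m)) else [::].
exists (F \o L) => n; have -> : mkseq (F \o L) n = L n; last exact: FP.
by elim: n => // n IH; rewrite mkseqS IH.
Qed.

Section orbit_continuity.
Context {R : realType} {G H : topologicalGroupType} {X Y : topologicalType}.
Variables (actX : G -> X -> X) (actY : H -> Y -> Y) (dH : H -> H -> R).
Variables (f : X -> Y) (D : set X) (O : nat -> set X).
Hypotheses (pG : polish R G) (pH : polish R H) (pX : polish R X) (pY : polish R Y).
Hypotheses (cX : continuous_action actX) (cY : continuous_action actY).
Hypotheses (dHc : compatible_metric dH) (dHr : right_invariant dH).
Hypotheses (oO : forall n, open (O n)) (dO : forall n, dense (O n)).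
Hypothesis cf : continuous_on (\bigcap_n O n) f.
Hypotheses (D_almost_open : almost_open D) (D_invariant : invariant_set actX D).
Hypothesis f_orbit : forall g x, D x -> orbit_eq actY (f x) (f (actX g x)).

Let C0 := \bigcap_n O n.

(** Vacuous off [D], so that category quantifiers can range over all of [X]. *)
Let moved_by (L : set H) : set (G * X) :=
  [set p | D p.2 -> exists2 h, L h & actY h (f p.2) = f (actX p.1 p.2)].

Lemma comeager_C0 : comeager C0.
Proof. by apply/comeagerP; exists O; split. Qed.

(** For generic [(g, x)] both [x] and [g x] lie in [C0], where [f] restricts to a continuous map.
    There the triples [(g, x, h)] with [h] in [L] and [h (f x) = f (g x)] are relatively closed in a
    G-delta set, and their projection is analytic. *)
Lemma almost_open_moved_by L : open L -> almost_open (moved_by L).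
Proof.
move=> oL; apply: (@almost_open_imply _ [set p : G * X | D p.2]
  [set p | exists2 h, L h & actY h (f p.2) = f (actX p.1 p.2)]).
  have [U oU DU] := D_almost_open; exists (snd @^-1` U).
    by apply: open_comp => // ? _; exact: cvg_snd.
  exact: (@comeager_snd_preimage G X [set x | D x <-> U x]).
pose ax (q : G * X * H) := actX q.1.1 q.1.2.
have cfst : continuous (fun q : G * X * H => q.1) by move=> ?; exact: cvg_fst.
have cx : continuous (fun q : G * X * H => q.1.2).
  by move=> q; apply: (cvg_comp _ _ (cfst q)); exact: cvg_snd.
have cax : continuous ax.
  move=> q; apply: (cvg_act cX); last exact: cx.
  by apply: (cvg_comp _ _ (cfst q)); exact: cvg_fst.
pose O' n := [set q : G * X * H | [/\ O n q.1.2, O n (ax q) & L q.2]].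
have oO' n : open (O' n).
  have -> : O' n = (fun q : G * X * H => q.1.2) @^-1` O n `&` (ax @^-1` O n `&`
      snd @^-1` L).
    by apply/seteqP; split=> [q []|q [? []]].
  apply: openI; first by apply: open_comp => // q _; exact: cx.
  apply: openI.
    by apply: open_comp (oO n) => q _; exact: (cax q).
  by apply: open_comp oL => q _; exact: cvg_snd.
pose W := \bigcap_n O' n.
have WC0 q : W q -> C0 q.1.2 by move=> Wq n _; have [] := Wq n I.
have WC0' q : W q -> C0 (ax q) by move=> Wq n _; have [] := Wq n I.
pose u (q : G * X * H) := actY q.2 (f q.1.2); pose v (q : G * X * H) := f (ax q).
have cv : continuous_on W v.
  by apply: continuous_on_comp WC0' _ cf; exact: continuous_continuous_on.
have cfx : continuous_on W (fun q => f q.1.2).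
  by apply: (continuous_on_comp WC0 _ cf); exact: continuous_continuous_on.
have cu : continuous_on W u.
  move=> q Wq; apply: (@cvg_act _ _ _ cY _ (within W (nbhs q)) _ snd
    (fun q => f q.1.2)); last exact: cfx.
  by apply: (@continuous_continuous_on _ _ W snd) => // ?; exact: cvg_snd.
have E := continuous_on_eq_closed (polish_hausdorff pY) cu cv.
have pP : polish R (G * X * H)%type by do 2?apply: polish_prod.
have := almost_open_image (@closed_closure _ [set q | W q /\ u q = v q]) oO' pP
  (polish_prod pG pX) (@continuous_continuous_on _ _ _ fst cfst).
rewrite E; apply: almost_open_ae.
have cC1 := comeager_snd_preimage G comeager_C0.
have cC2 := comeager_act_preimage cX comeager_C0.
apply: filterS2 cC1 cC2 => -[g x] /= C0x C0gx; split.
  move=> [[[g' x'] h] [Wq uv] [gg' xx']]; rewrite -gg' -xx'.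
  by exists h => //; have [] := Wq 0%N I.
move=> [h Lh hx]; exists ((g, x), h) => //; split=> // n _.
by split => //=; [exact: C0x|exact: C0gx].
Qed.

(** Let [h0] move [f x] to [f (g0 x)], and let [BH j] be a small neighbourhood of [h0]. By the Baire
    property, for generic [g] near 1 some [h] in [BH j] moves [f x] to [f (g g0 x)]. Then
    [h * h0^-1] moves [f (g0 x)] there, and it is small by right invariance. *)
Lemma orbit_locally_small k : \forall* x, \forall* g0,
  exists V : set G, [/\ open V, V 1%g &
    \forall* g, V g -> moved_by [set h | dH h 1%g < 2^-1 ^+ k] (g, actX g0 x)].
Proof.
have [BG BGP] := polish_base pG; have [BH [oBH BHP]] := polish_base pH.
have /choice[U UP] : forall j, exists U, open U /\
    \forall* p, moved_by (BH j) p <-> U p.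
  by move=> j; have [U oU UP] := almost_open_moved_by (oBH j); exists U.
have : \forall* p, forall j, moved_by (BH j) p <-> U j p.
  by apply: comeager_forall => j; have [] := UP j.
move=> /(kuratowski_ulam BGP); apply: filterS => x MU.
apply: filterS (MU) => g0 MU0.
have [Dx|nDx] := pselect (D x); last first.
  exists setT; split=> //; first exact: openT.
  apply: filterE => g _ /= /(D_invariant g0^-1%g).
  by rewrite (actVK cX).
have [h0 h0P] := f_orbit g0 Dx.
have k0 : 0 < (2^-1 ^+ k / 2 : R) by rewrite divr_gt0 ?exprn_gt0.
have [j [Bj jB]] := BHP _ _ (mball_nbhs dHc h0 k0).
exists [set g | U j (g * g0, x)%g]; split.
- apply: (@open_comp _ _ (fun g => (g * g0)%g) [set g | U j (g, x)]).
    by move=> ? _; exact: mulg_continuous_r.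
  by apply: open_section_l; have [] := UP j.
- by rewrite /= mul1g; apply/MU0 => /= _; exists h0.
have := comeager_mulg_r g0 MU; apply: filterS => g /(_ j) MUg /= /MUg /= /(_ Dx).
move=> [h /jB /= hB hP] _; exists (h * h0^-1)%g.
  rewrite /= -(dHr _ _ h0) mulgVK mul1g (cmetric_sym dHc).
  by apply: lt_trans hB _; rewrite ltr_pdivrMr// ltr_pMr ?exprn_gt0// ltr1n.
by rewrite (actM cY) -h0P (actVK cY) hP (actM cX).
Qed.

(** The neighbourhood of 1 becomes locally uniform in [x] by taking it from a countable base. For
    [x] in [C], [B i] works exactly when [O'] has a dense section in [B i], that is, when [Q i x];
    and on [C] the set [Q i] agrees with the open set [(closure (Q i))°]. *)
Lemma orbit_continuity_at k : exists2 C : set X, comeager C &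
  forall x0, C x0 -> exists (U : set X) (V : set G),
    [/\ open U, U x0, open V, V 1%g & forall x, U x -> C x ->
      \forall* g, V g -> moved_by [set h | dH h 1%g < 2^-1 ^+ k] (g, x)].
Proof.
have [B BP] := polish_base pG; have [oB BN] := BP.
set M := moved_by _.
have [ O' oO' MO] : almost_open M.
  apply: almost_open_moved_by; have := mball_open dHc 1%g (2^-1 ^+ k).
  by under eq_set do rewrite (cmetric_sym dHc).
have cMO := kuratowski_ulam BP MO.
pose P i := [set x | exists2 g, B i g & O' (g, x)].
have oP i : open (P i).
  have -> : P i = \bigcup_(g in B i) [set x | O' (g, x)] by [].
  by apply: bigcup_open => g _; exact: open_section_r.
pose Q i := [set x | forall j, B j !=set0 -> B j `<=` B i -> P j x].
pose C := [set x | \forall* g, M (g, x) <-> O' (g, x)] `&`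
  ([set x | forall i, closure (P i) x -> P i x] `&`
   [set x | forall i, closure (Q i) x -> (closure (Q i))° x]).
have cC : comeager C.
  apply: filterI => //; apply: filterI; apply: comeager_forall => i.
    exact: comeager_closure.
  exact/comeager_interior/closed_closure.
have CQ x i : C x -> Q i x -> \forall* g, B i g -> M (g, x).
  move=> [MOx _] Qx.
  have : \forall* g, B i g -> O' (g, x).
    apply: (comeager_open_in (O := [set g | O' (g, x)])) => //.
      exact: open_section_l.
    move=> N oN [g Ng] NB.
    have [j [Bj jN]] := BN _ _ (open_nbhs_nbhs (conj oN Ng)).
    have [||g' Bg' Og'] := Qx j; first by exists g.
      exact: subset_trans NB.
    by exists g'; split=> //; exact: jN.
  by apply: filterS2 MOx => g MOg BO /BO/MOg.
have CV x (V : set G) : C x -> open V -> V 1%g -> (\forall* g, V g -> M (g, x)) ->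
    exists2 i, B i 1%g & Q i x.
  move=> [MOx _] oV V1 VM.
  have [i [Bi iV]] := BN _ _ (open_nbhs_nbhs (conj oV V1)).
  exists i => // j B0 Bji.
  have [g [Bg [VMg MOg]]] := comeager_dense pG (filterI VM MOx) B0 (oB j).
  by exists g => //; apply/MOg/VMg/iV/Bji.
have Cint x i : C x -> (closure (Q i))° x -> Q i x.
  move=> [_ [CP _]] /interior_subset clQ j B0 Bji; apply: CP.
  by apply: closure_subset clQ => y; apply.
pose U := \bigcup_(i in [set i | B i 1%g]) (closure (Q i))°.
have oU : open U by apply: bigcup_open => i _; exact: open_interior.
have cU : \forall* x, \forall* g, U (actX g x).
  have := kuratowski_ulam BP (comeager_act_preimage cX cC).
  apply: filterS2 (orbit_locally_small k) => x H1 H2.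
  apply: filterS2 H1 H2 => g [V [oV V1 VM]] /= Cgx.
  have [i Bi Qi] := CV _ V Cgx oV V1 VM.
  by exists i => //; case: Cgx => _ [_]; apply; exact: subset_closure.
(* For a generic [x] in [N], generic [g] give [g x] in [U], and some such [g] keeps [g x] in [N]. *)
have dU : dense U.
  move=> N N0 oN; have [x [Nx Ux]] := comeager_dense pX cU N0 oN.
  have oN' : open [set g | N (actX g x)].
    by apply: open_comp => // ? _; exact: act_continuous_l.
  have [|g [Ng Ug]] := comeager_dense pG Ux _ oN'; last by exists (actX g x).
  by exists 1%g; rewrite /= (act1 cX).
exists (C `&` U); first by apply: filterI => //; exact: comeager_open_dense.
move=> x0 [Cx0 [i Bi Qi]]; exists (closure (Q i))°, (B i); split=> //.
  exact: open_interior.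
by move=> x Qx [Cx _]; apply: CQ => //; exact: Cint.
Qed.

Lemma orbit_continuity : exists2 C : set X, comeager C /\ C `<=` C0 &
  forall k x0, C x0 -> exists (U : set X) (V : set G),
    [/\ open U, U x0, open V, V 1%g & forall x, U x -> C x ->
      \forall* g, V g -> moved_by [set h | dH h 1%g < 2^-1 ^+ k] (g, x)].
Proof.
have /choice[C CP] : forall k, exists C : set X, comeager C /\
    forall x0, C x0 -> exists (U : set X) (V : set G),
      [/\ open U, U x0, open V, V 1%g & forall x, U x -> C x ->
        \forall* g, V g -> moved_by [set h | dH h 1%g < 2^-1 ^+ k] (g, x)].
  by move=> k; have [C cC CP] := orbit_continuity_at k; exists C.
exists (C0 `&` \bigcap_k C k).
  split; last by move=> x [].
  apply: filterI; first exact: comeager_C0.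
  by apply: comeager_bigcap => k; have [] := CP k.
move=> k x0 [_ Cx0]; have [_ /(_ x0 (Cx0 k I))[U [V [oU Ux0 oV V1 UV]]]] := CP k.
by exists U, V; split=> // x Ux [_ Cx]; apply: UV => //; exact: Cx.
Qed.

(* A right-Cauchy witness (g_n) for x, x' is first perturbed to a sequence (u_n)
   generic enough for orbit continuity to apply to all pairs u_m x', u_n x'.
   The points f (u_n x') are then linked by small elements of H, and the
   products of these elements along a subsequence form a right-Cauchy witness
   for f x, f x'. *)
Lemma right_embeds_image : exists C : set X, [/\ comeager C, invariant_set actX C &
  forall x x', C x -> C x' -> D x -> D x' ->
    right_embeds actX R x x' -> right_embeds actY R (f x) (f x')].
Proof.
have [B BP] := polish_base pG.
have [C1 [cC1 C10] C1P] := orbit_continuity.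
(* The Vaught transform of [C1]: invariant, and comeager by Kuratowski-Ulam. *)
exists [set x | \forall* g, C1 (actX g x)]; split.
- exact: kuratowski_ulam BP (comeager_act_preimage cX cC1).
- move=> k x /= /(comeager_mulg_r k); apply: filterS => g /=.
  by rewrite (actM cX).
move=> x0 x' Cx0 Cx' Dx0 Dx' re.
(* Orbit continuity is applied around the limit point, so that point is moved into [C1] within its
   orbit. For [x'] it suffices that generic translates are in [C1]. *)
have [g0 [_ C1x]] := comeager_dense pG Cx0 (ex_intro _ 1%g I) openT.
have [h0 h0P] := f_orbit g0 Dx0.
rewrite -(actVK cY h0 (f x0)) -(act1 cY (f x')) h0P.
apply: right_embeds_orbit => //.
have {re} := right_embeds_orbit g0 1%g cX re; rewrite (act1 cX).
move: (D_invariant g0 Dx0) (C1x : C1 (actX g0 x0)).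
move: (actX g0 x0) => {C1x h0 h0P Cx0 Dx0 g0 x0} x Dx C1x.
case=> g [[d' [dGc' dGr' dgC]] gx].
have [d dc dr] := birkhoff_kakutani pG.
(* Near 1 the metric [d'] controls [d], and right invariance carries this control to all pairs. *)
have gC : cauchy_for d g.
  move=> e e0.
  have /(cmetric_nbhsP dGc')[r r0 rP] := mball_nbhs dc 1%g e0.
  have [N NP] := dgC r r0; exists N => m n Nm Nn.
  rewrite -(dr _ _ (g m)^-1%g) mulgV; apply: rP.
  by rewrite /= -(mulgV (g m)) dGr'; exact: NP.
have /choice[UV UVP] : forall k, exists UV : set X * set G,
    [/\ open UV.1, UV.1 x, open UV.2, UV.2 1%g & forall y, UV.1 y -> C1 y ->
    \forall* g, UV.2 g -> moved_by [set h | dH h 1%g < 2^-1 ^+ k] (g, y)].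
  by move=> k; have [U [V UVk]] := C1P k x C1x; exists (U, V).
pose U k := (UV k).1; pose V k := (UV k).2.
(* The new term [t] must be generic against every earlier [t'] and every scale [k] at once:
   countably many comeager conditions, satisfied by some [t] in the ball around [g (size s)]. *)
pose P s t := [/\ d (g (size s)) t < 2^-1 ^+ size s, C1 (actX t x') &
  forall k i, (i < size s)%N -> let t' := nth 1%g s i in C1 (actX t' x') ->
    U k (actX t' x') -> V k (t * t'^-1)%g ->
    moved_by [set h | dH h 1%g < 2^-1 ^+ k] ((t * t'^-1)%g, actX t' x')].
have /history_choice[u uP] : forall s, exists t, P s t.
  move=> s.
  have generic k i : \forall* t, let t' := nth 1%g s i in C1 (actX t' x') ->
    U k (actX t' x') -> V k (t * t'^-1)%g ->
    moved_by [set h | dH h 1%g < 2^-1 ^+ k] ((t * t'^-1)%g, actX t' x').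
    set t' := nth _ _ _.
    have [[C1t Ut]|nCU] := pselect (C1 (actX t' x') /\ U k (actX t' x')); last first.
      by apply: filterE => t /= ? ?; case: nCU.
    have [_ _ _ _ /(_ _ Ut C1t)/(comeager_mulg_r t'^-1%g)] := UVP k.
    by apply: filterS => t /= tV _ _; exact: tV.
  have := comeager_forall (fun k => comeager_forall (generic k)).
  move=> /(filterI Cx')/(comeager_dense pG).
  have s0 : 0 < 2^-1 ^+ size s :> R by rewrite exprn_gt0.
  move=> /(_ [set t | d (g (size s)) t < 2^-1 ^+ size s]).
  case=> [||t [gt [C1t tP]]].
  - by exists (g (size s)); rewrite /= (cmetric_refl dc).
  - exact: mball_open.
  - by exists t; split=> // k i _; exact: tP.
have du n : d (g n) (u n) < 2^-1 ^+ n by have [] := uP n; rewrite size_mkseq.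
have C1u n : C1 (actX (u n) x') by have [] := uP n.
have uP' k i n : (i < n)%N -> U k (actX (u i) x') -> V k (u n * (u i)^-1)%g ->
    exists2 h, dH h 1%g < 2^-1 ^+ k &
      actY h (f (actX (u i) x')) = f (actX (u n) x').
  move=> i_n Ui Vi; have [_ _ /(_ k i)] := uP n.
  rewrite size_mkseq nth_mkseq// => /(_ i_n (C1u i) Ui Vi (D_invariant _ Dx'))/=.
  by rewrite -(actM cX) mulgVK.
have small e : 0 < e -> exists N, forall n, (N <= n)%N -> 2^-1 ^+ n < e :> R.
  move=> e0; have [N _ NP] := near_infty_natSinv_expn_lt (PosNum e0).
  by exists N => n /NP /=; rewrite div1r -exprVn.
have ux : actX (u n) x' @[n --> \oo] --> x.
  have -> : (fun n => actX (u n) x') =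
      (fun n => actX (u n * (g n)^-1)%g (actX (g n) x')).
    by apply/funext => n; rewrite -(actM cX) mulgVK.
  rewrite -(act1 cX x); apply: (cvg_act cX) gx; apply/(cmetric_cvgP dc) => e e0.
  have [N NP] := small e e0; exists N => // n /= /NP.
  by apply: lt_trans; rewrite -(dr _ _ (g n)) mul1g mulgVK.
have uC : cauchy_for d u.
  move=> e e0; have e3 : 0 < e / 3 by rewrite divr_gt0.
  have [N NP] := small _ e3; have [M MP] := gC _ e3.
  exists (maxn N M) => m n; rewrite !geq_max => /andP[Nm Mm] /andP[Nn Mn].
  have := MP _ _ Mm Mn; have := NP _ Nm; have := NP _ Nn.
  have := du m; have := du n; rewrite (cmetric_sym dc (g m)).
  have := cmetric_triangle dc (u m) (g m) (u n).
  have := cmetric_triangle dc (g m) (g n) (u n); lra.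
pose y n := f (actX (u n) x').
have yx : y @ \oo --> f x.
  apply: (continuous_on_cvg cf _ _ ux) => [|n]; first exact: C10.
  exact: C10.
have /choice[N NP] : forall k, exists N, forall m n, (N <= m)%N -> (m < n)%N ->
    exists2 h, dH h 1%g < 2^-1 ^+ k & actY h (y m) = y n.
  move=> k; have [oU Ux oV V1 _] := UVP k.
  have [N1 _ N1P] := ux _ (open_nbhs_nbhs (conj oU Ux)).
  have /(cmetric_nbhsP dc)[e e0 eV] := open_nbhs_nbhs (conj oV V1).
  have [N2 N2P] := uC e e0.
  exists (maxn N1 N2) => m n; rewrite geq_max => /andP[N1m N2m] mn.
  apply: uP' => //; first exact: N1P.
  apply: eV; rewrite /= -(dr _ _ (u m)) mul1g mulgVK; apply: N2P => //.
  exact/ltnW/(leq_ltn_trans N2m).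
(* Being beyond [N k] and strictly increasing, consecutive indices [j k] and [j k.+1] are linked by
   an element of size below [2^-k]. *)
pose j := fix j k := if k is l.+1 then maxn (j l).+1 (N k) else N 0%N.
have jN k : (N k <= j k)%N by case: k => //= k; exact: leq_maxr.
have jS k : (j k < j k.+1)%N by rewrite /= leq_max leqnn.
have jk k : (k <= j k)%N by elim: k => // k IH; exact: leq_ltn_trans (jS k).
have /choice[w wP] : forall k, exists h, dH h 1%g < 2^-1 ^+ k /\
    actY h (y (j k)) = y (j k.+1).
  by move=> k; have [h ? ?] := NP k _ _ (jN k) (jS k); exists h.
have [h0 h0P] := f_orbit (u (j 0%N)) Dx'.
(* Multiplying on the left makes the distance from [h k.+1] to [h k] equal to the size of [w k],
   which is summable. *)
pose h := fix h k := if k is l.+1 then (w l * h l)%g else h0.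
have hy k : actY (h k) (f x') = y (j k).
  by elim: k => //= k IH; rewrite (actM cY) IH; have [] := wP k.
exists h; split.
  exists dH; split=> //; apply: (geometric_cauchy dHc) => k /=.
  by rewrite -{2}(mul1g (h k)) dHr; have [] := wP k.
have -> : (fun k => actY (h k) (f x')) = y \o j by apply/funext => k; exact: hy.
by move=> A /yx[M _ MA]; exists M => // k /= Mk; apply: MA => /=; exact: leq_trans (jk k).
Qed.

End orbit_continuity.

(** * Saturations and the inverse homomorphism *)

Section orbit_equivalence.
Context {G : topologicalGroupType} {X : topologicalType} (act : G -> X -> X).
Hypothesis cA : continuous_action act.

Lemma orbit_eq_sym x y : orbit_eq act x y -> orbit_eq act y x.
Proof. by move=> [g <-]; exists g^-1%g; rewrite (actVK cA). Qed.

Lemma orbit_eq_trans x y z : orbit_eq act x y -> orbit_eq act y z -> orbit_eq act x z.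
Proof. by move=> [g <-] [h <-]; exists (h * g)%g; rewrite (actM cA). Qed.

Lemma orbit_eq_act g x : orbit_eq act x (act g x).
Proof. by exists g. Qed.

Lemma orbit_of_inj x y : orbit_of act x = orbit_of act y -> orbit_eq act x y.
Proof.
move=> xy; have : orbit_of act y y by exists 1%g; rewrite ?(act1 cA).
by rewrite -xy => -[g _ <-]; exists g.
Qed.

Lemma invariant_dense_Gdelta (R : realType) (C : set X) :
  polish R G -> polish R X -> comeager C -> exists X0,
    [/\ invariant_set act X0, comeager X0, Gdelta X0 &
      forall x, X0 x -> exists g, C (act g x)].
Proof.
move=> pG pX /comeagerP[ O [oO dO OC]]; have [B [oB BP]] := polish_base pG.
pose W n i := \bigcup_(g in [set g | B i !=set0 -> B i g]) act g @^-1` O n.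
have oW n i : open (W n i).
  apply: bigcup_open => g _; apply: open_comp => // ? _.
  exact: act_continuous_r.
have dW n i : dense (W n i).
  have [g Bg] : exists g, B i !=set0 -> B i g.
    have [[g Bg]|B0] := pselect (B i !=set0); first by exists g.
    by exists 1%g => /B0.
  move=> N [x Nx] oN.
  have [||y [Ny Oy]] := dO n (act g^-1%g @^-1` N).
  - by exists (act g x); rewrite /= (actVK cA).
  - by apply: open_comp => // ? _; exact: act_continuous_r.
  by exists (act g^-1%g y); split=> //; exists g => //=; rewrite (actKV cA).
pose A k := if unpickle k is Some (n, i) then W n i else setT.
have AE : \bigcap_k A k = [set x | forall n i, W n i x].
  apply/seteqP; split=> x Ax => [n i|k _].
    by have := Ax (pickle (n, i)) I; rewrite /A pickleK.
  by rewrite /A; case: unpickle => [[n i]|].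
exists (\bigcap_k A k); split.
- rewrite AE => k x Wx n i; have [[g Bg]|B0] := pselect (B i !=set0); last first.
    by have [g _ Og] := Wx n i; exists (g * k^-1)%g => [/B0//|];
      rewrite /= -(actM cA) mulgVK.
  have oBk : open [set h | B i (h * k^-1)%g].
    by apply: open_comp => // ? _; exact: mulg_continuous_r.
  have [|j [Bj jB]] := BP (g * k)%g [set h | B i (h * k^-1)%g].
    by apply: open_nbhs_nbhs; split => //=; rewrite mulgK.
  have [h Bh Oh] := Wx n j; exists (h * k^-1)%g => [_|].
    by apply: jB; apply: Bh; exists (g * k)%g.
  by rewrite /= -(actM cA) mulgVK.
- rewrite AE; apply: comeager_forall => n; apply: comeager_forall => i.
  exact: comeager_open_dense.
- exists A => // k; rewrite /A; case: unpickle => [[n i]//|]; exact: openT.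
- rewrite AE => x Wx.
  have cx : \forall* g, forall n, O n (act g x).
    apply: comeager_forall => n; apply: comeager_open_dense.
      by apply: open_comp => // ? _; exact: act_continuous_l.
    move=> N [g Ng] oN; have [i [Bi iN]] := BP _ _ (open_nbhs_nbhs (conj oN Ng)).
    have [h Bh Oh] := Wx n i; exists h; split=> //; apply: iN; apply: Bh.
    by exists g.
  have [g [_ Og]] := comeager_dense pG cx (ex_intro _ 1%g I) openT.
  by exists g; apply: OC => n _; exact: Og.
Qed.

End orbit_equivalence.

Lemma baire_measurable_map_continuous_on (R : realType) (X Y : topologicalType)
    (f : X -> Y) : polish R Y -> baire_measurable_map f ->
  exists O : nat -> set X,
    [/\ forall n, open (O n), forall n, dense (O n) & continuous_on (\bigcap_n O n) f].
Proof.
move=> pY bf; have [B [oB BP]] := polish_base pY.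
have /choice[U UP] : forall n, exists U : set X, open U /\
    \forall* x, (f @^-1` B n) x <-> U x.
  by move=> n; have /baire_measurableP[U oU fU] := bf _ (oB n); exists U.
have : \forall* x, forall n, (f @^-1` B n) x <-> U n x.
  by apply: comeager_forall => n; have [] := UP n.
case/comeagerP=> O [oO dO OU]; exists O; split=> // x Ox A.
move=> /BP[n [Bn BA]].
have Ux : U n x by apply/OU.
have oU : open (U n) by have [] := UP n.
apply: filterS (open_nbhs_nbhs (conj oU Ux)) => y Uy Oy.
by apply: BA; apply/OU.
Qed.

Section saturation.
Context {R : realType} {H : topologicalGroupType} {X Y : topologicalType}.
Variables (actY : H -> Y -> Y) (f : X -> Y) (O : nat -> set X).
Hypotheses (pH : polish R H) (pX : polish R X) (pY : polish R Y).
Hypothesis cY : continuous_action actY.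
Hypothesis oO : forall n, open (O n).
Hypothesis cf : continuous_on (\bigcap_n O n) f.

Definition saturation (Z : set X) : set Y :=
  [set y | exists2 x, Z x & orbit_eq actY (f x) y].

Let phi (p : H * X) := actY p.1 (f p.2).
Let S := [set: H * X] `&` \bigcap_n (snd @^-1` O n).

Let SE p : S p <-> (\bigcap_n O n) p.2.
Proof. by split=> [[_ Op]|Op]; [|split]. Qed.

Let image_phi : phi @` S = saturation (\bigcap_n O n).
Proof.
apply/seteqP; split=> [_ [p /SE Op <-]|y [x Ox [h hy]]].
  by exists p.2 => //; exists p.1.
by exists (h, x) => //; apply/SE.
Qed.

Let oS n : open (snd @^-1` O n : set (H * X)).
Proof. by apply: open_comp => // ? _; exact: cvg_snd. Qed.

Let cphi : continuous_on S phi.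
Proof.
move=> p Sp; apply: (@cvg_act _ _ _ cY _ (within S (nbhs p)) _ fst (fun q => f q.2)).
  by apply: (@continuous_continuous_on _ _ S fst) => // ?; exact: cvg_fst.
apply: (continuous_on_comp _ _ cf) => // [q /SE//|].
by apply: continuous_continuous_on => ?; exact: cvg_snd.
Qed.

Lemma almost_open_saturation : almost_open (saturation (\bigcap_n O n)).
Proof.
rewrite -image_phi; exact: (almost_open_image closedT oS (polish_prod pH pX) pY cphi).
Qed.

(** [h] must be correct on all of [E], while uniformization speaks only of [C] and [K]; elsewhere on
    [E] the value is chosen arbitrarily among correct ones, and off [E] it is [x0]. On [D] this is
    harmless for continuity: there [E] coincides with [K], which is relatively open and closed. *)
Lemma saturation_section (x0 : X) : exists (h : Y -> X) (U : nat -> set Y),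
  [/\ forall n, open (U n), forall n, dense (U n),
      continuous_on (\bigcap_n U n) h &
      forall y, saturation (\bigcap_n O n) y -> orbit_eq actY (f (h y)) y].
Proof.
have [s [C [cC sP cs]]] :=
  uniformization closedT oS (1%g, x0) (polish_prod pH pX) pY cphi.
have [BY BYP] := polish_base pY.
move: sP cs; rewrite -/S image_phi.
set E := saturation _; set K := nonmeager_at E => sP cs.
pose sect y := [set x | [/\ E y, orbit_eq actY (f x) y & C y -> K y -> x = (s y).2]].
pose h y := xget x0 (sect y).
have hE y : E y -> sect y (h y).
  move=> Ey; apply: xgetPex; have [[Cy Ky]|CK] := pselect (C y /\ K y).
    by exists (s y).2; split=> //; exists (s y).1; have [] := sP y Cy Ky.
  by case: (Ey) => x _ xy; exists x; split=> // Cy Ky; case: CK.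
have hN y : ~ E y -> h y = x0.
  by move=> nE; apply: xgetPN => x [].
pose D := C `&` ([set y | E y -> K y] `&` [set y | K y -> K° y]).
have cD : comeager D.
  apply: filterI => //; apply: filterI; first exact: nonmeager_at_comeager BYP.
  exact/comeager_interior/closed_nonmeager_at.
have hK y : D y -> K y -> h y = (s y).2.
  move=> [Cy _] Ky; have [Ss sy] := sP y Cy Ky.
  have Ey : E y.
    by rewrite -sy; exists (s y).2; [exact/SE|exact: orbit_eq_act].
  by have [_ _ ->] := hE y Ey.
have [U [oU dU UD]] := (comeagerP D).1 cD.
exists h, U; split=> // [y Uy A|y /hE[]//].
apply: (continuous_on_subset UD) Uy _ => {}y Dy {}A.
have [Ky|nKy] := pselect (K y).
  have cs2 : continuous_on (C `&` K) (snd \o s).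
    apply: (continuous_on_comp (E := setT) _ cs) => //.
    by apply: continuous_continuous_on => ?; exact: cvg_snd.
  rewrite hK// => sA; have CKy : (C `&` K) y by case: Dy.
  have nK : nbhs y K by case: Dy => _ [_]; apply.
  apply: filterS2 nK (cs2 y CKy A sA) => z Kz CKA Dz; rewrite hK//; apply: CKA.
  by case: Dz.
rewrite hN => [x0A|Ey]; last by apply: nKy; case: Dy => _ [+ _]; apply.
have oK : open (~` K) by exact/closed_openC/closed_nonmeager_at.
apply: filterS (open_nbhs_nbhs (conj oK nKy)) => z nKz [_ [EK _]].
by rewrite hN; [exact: nbhs_singleton x0A|move=> /EK].
Qed.

End saturation.

Theorem theorem3 (R : realType) (G H : topologicalGroupType)
    (X Y : topologicalType) (actX : G -> X -> X) (actY : H -> Y -> Y)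
    (f : X -> Y)
    (G_polish : polish_group R G) (H_polish : polish_group R H)
    (X_Gspace : polish_Gspace R actX) (Y_Hspace : polish_Gspace R actY)
    (X_nonempty : [set: X] !=set0)
    (f_red : star_reduction (orbit_eq actX) (orbit_eq actY) f) :
  exists (X0 : set X) (Y0 : set Y),
    [/\ invariant_set actX X0, dense X0 & Gdelta X0] /\
    [/\ invariant_set actY Y0, ~ meager Y0 & baire_measurable Y0] /\
    digraph_iso (becker_digraph actX R X0) (becker_digraph actY R Y0)
      (orbit_map actY f).
Proof.
have [pX cX] := X_Gspace; have [pY cY] := Y_Hspace; have [bf pf fE] := f_red.
have [dG dGc dGr] := birkhoff_kakutani G_polish.
have [dH dHc dHr] := birkhoff_kakutani H_polish.
have [ O [oO dO cf]] := baire_measurable_map_continuous_on pY bf.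
have [x0 _] := X_nonempty.
have [h [U [oU dU ch hP]]] := saturation_section H_polish pX pY cY oO cf x0.
set E := saturation actY f (\bigcap_n O n) in hP.
have h_red y y' : E y -> E y' -> orbit_eq actY y y' -> orbit_eq actX (h y) (h y').
  move=> /hP hy /hP hy' yy'; apply/fE.
  exact: (orbit_eq_trans cY) (orbit_eq_trans cY hy yy') (orbit_eq_sym cY hy').
have invE : invariant_set actY E.
  move=> k y [x Ox xy]; exists x => //; apply: (orbit_eq_trans cY xy).
  exact: orbit_eq_act.
have aoE : almost_open E := almost_open_saturation H_polish pX pY cY oO cf.
have aoT : almost_open [set: X] by exists setT => //; [exact: openT|exact: filterE].
have [Cf [cCf invCf CfP]] := right_embeds_image G_polish H_polish pX pY cX cY dHc dHr
  oO dO cf aoT (fun _ _ _ => I)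
  (fun g x _ => (fE _ _).1 (orbit_eq_act actX g x)).
(* The roles of the groups are exchanged, and the domain is [E], as [h] is a homomorphism only
   there. *)
have [Ch [cCh invCh ChP]] := right_embeds_image H_polish G_polish pY pX cY cX dGc dGr
  oU dU ch aoE invE
  (fun k y Ey => h_red _ _ Ey (invE k y Ey) (orbit_eq_act actY k y)).
have cC : comeager (\bigcap_n O n `&` (Cf `&` f @^-1` Ch)).
  apply: filterI; first by apply/comeagerP; exists O; split.
  by apply: filterI => //; exact: (pf _ cCh).
have [X0 [invX0 cX0 GX0 X0C]] := invariant_dense_Gdelta cX G_polish pX cC.
have X0P x : X0 x -> [/\ Cf x, Ch (f x) & E (f x)].
  move=> /X0C[g [Ogx [Cfgx Chgx]]].
  have [k kf] : orbit_eq actY (f (actX g x)) (f x).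
    by apply/fE/(orbit_eq_sym cX)/orbit_eq_act.
  split.
  - by rewrite -(actVK cX g x); exact: invCf.
  - by rewrite -kf; exact: invCh.
  - by exists (actX g x) => //; exists k.
pose Y0 := saturation actY f X0.
have fY0 x : X0 x -> Y0 (f x) by move=> ?; exists x => //; exists 1%g; rewrite (act1 cY).
exists X0, Y0; split; first by split=> //; exact: comeager_dense pX cX0.
split.
  split.
  - move=> k y [x X0x xy]; exists x => //; apply: (orbit_eq_trans cY xy).
    exact: orbit_eq_act.
  (* Category preservation again: otherwise the preimage of [Y0], which contains the comeager set
     [X0], would be meager in the nonempty Polish space [X]. *)
  - move=> mY0; have mX0 : comeager (~` (f @^-1` Y0)).
      by rewrite /comeager /mkset setCK; exact: pf.
    have [x [_ [X0x]]] := comeager_dense pX (filterI cX0 mX0) X_nonempty openT.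
    by apply; exact: fY0.
  (* Every orbit in [X0] meets the intersection of the [O n], so cutting [X0] down to it keeps the
     saturation and leaves a G-delta set on which [f] is continuous. *)
  - have [A oA X0A] := GX0.
    have AO : \bigcap_n (A n `&` O n) = X0 `&` \bigcap_n O n.
      by rewrite bigcapI -X0A.
    have -> : Y0 = saturation actY f (\bigcap_n (A n `&` O n)).
      rewrite AO; apply/seteqP; split=> y [x + xy]; last first.
        by move=> [X0x _]; exists x.
      move=> X0x; have [g [Ogx _]] := X0C x X0x.
      exists (actX g x); first by split=> //; exact: invX0.
      by apply: (orbit_eq_trans cY) xy; apply/fE/(orbit_eq_sym cX)/orbit_eq_act.
    apply/baire_measurableP/(almost_open_saturation H_polish pX pY cY).
      by move=> n; exact: openI.
    by rewrite AO; apply: continuous_on_subset cf => x [].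
have fO x : orbit_map actY f (orbit_of actX x) = orbit_of actY (f x).
  by apply: orbit_mapE => // ? ? /fE.
split; first split.
- by move=> _ [x X0x <-]; rewrite fO; exists (f x) => //; exact: fY0.
- move=> _ _ /set_mem[x X0x <-] /set_mem[x' X0x' <-]; rewrite !fO.
  by move=> /(orbit_of_inj cY)/fE; exact: orbit_of_eq.
- move=> _ [y [x X0x xy] <-]; exists (orbit_of actX x); first by exists x.
  by rewrite fO; exact: orbit_of_eq.
move=> _ _ [x X0x <-] [x' X0x' <-]; rewrite !fO !becker_arrowE//; try exact: fY0.
have [Cfx Chx Ex] := X0P x X0x; have [Cfx' Chx' Ex'] := X0P x' X0x'.
split; first exact: CfP.
(* The arrow comes back between [h (f x)] and [h (f x')], which are then moved to [x] and [x']
   within their orbits. *)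
move=> /(ChP _ _ Chx Chx' Ex Ex').
have [g gx] : orbit_eq actX (h (f x)) x by apply/fE; exact: hP.
have [g' gx'] : orbit_eq actX (h (f x')) x' by apply/fE; exact: hP.
by move=> /(right_embeds_orbit g g' cX); rewrite gx gx'.
Qed.
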